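(* Let $d\ge 1$, let $\mu$ be a probability measure on $\mathbb{R}^d$, and let $Z(x)$, $x\in\mathbb{R}^d$, be a Gaussian process with known mean and covariance kernel $k(x,x')\in\mathcal{C}^0(\mathbb{R}^d\times\mathbb{R}^d)$ such that $\sup_{x\in\mathbb{R}^d}k(x,x)<\infty$. Let $(x_i)_{i=1,\dots,n}$ be $n$ independent random points sampled from $\mu$, and let $\tau>0$ be a constant independent of $n$. Let $(\lambda_p)_{p\ge 0}$ be the eigenvalues, sorted in decreasing order, of the operator $(T_{\mu,k}f)(x)=\int_{\mathbb{R}^d}k(x,x')f(x')\,d\mu(x')$ on $L^2_\mu(\mathbb{R}^d)$. Define $$\mathrm{IMSE}=\int_{\mathbb{R}^d}\sigma^2(x)\,d\mu(x),\qquad \sigma^2(x)=k(x,x)-k(x)^T(K+n\tau I)^{-1}k(x).$$ If the kernel $k$ is non-degenerate, then, as $n\to\infty$, $$\mathrm{IMSE}\longrightarrow\sum_{p\ge 0}\frac{\tau\lambda_p}{\tau+\lambda_p}$$ in probability. If the kernel $k$ is degenerate, the same convergence holds almost surely. (Probability and almost sure refer to the distribution of the random points $(x_i)$.)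
   Context: Notation: $k(x)=[k(x,x_i)]_{1\le i\le n}$ is an $n$-vector, $K=[k(x_i,x_j)]_{1\le i,j\le n}$ is an $n\times n$ matrix, and $I$ is the $n\times n$ identity matrix. The quantity $\sigma^2(x)$ is the mean squared error of the Best Linear Unbiased Predictor of $Z(x)$ from observations $Z(x_i)+\varepsilon(x_i)$, $i=1,\dots,n$, with independent Gaussian noises of mean zero and variance $n\tau$; the IMSE (integrated mean squared error) is also called the generalization error or learning curve. The space $L^2_\mu(\mathbb{R}^d)$ is the space of functions that are square integrable with respect to $\mu$; the eigenvalues $\lambda_p$ are nonnegative, counted with multiplicity, and correspond to an orthonormal basis of eigenfunctions $(\phi_p)_p$ of $L^2_\mu(\mathbb{R}^d)$. The kernel is called non-degenerate if $\lambda_p>0$ for all $p>0$ (infinitely many eigenvalues), and degenerate if only a finite number of the $\lambda_p$ are not zero. *)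

(* Defs.v *)
From HB Require Import structures.
From mathcomp Require Import all_boot all_order all_algebra finmap.
From mathcomp Require Import all_classical all_reals all_analysis.

Set Implicit Arguments.
Unset Strict Implicit.
Unset Printing Implicit Defensive.

Import Order.TTheory GRing.Theory Num.Theory.
Import numFieldNormedType.Exports.

Local Open Scope classical_set_scope.
Local Open Scope ring_scope.

(* R^d with its Borel sigma-algebra; convertible to 'rV[R]_d, from which it
   does not inherit the topology. *)
Definition borelRd (R : realType) (d : nat) :=
  g_sigma_algebraType (@open 'rV[R]_d).

(* The Dirac case is separate because normal_prob m 0 is not a point mass in
   the library. *)
Definition gaussian_law (R : realType) (dO : measure_display)
    (O : measurableType dO) (P : probability O R) (Y : O -> R) : Prop :=
  (exists m s : R, 0 < s /\
     forall A : set R, measurable A -> P (Y @^-1` A) = normal_prob m s A) \/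
  (exists m : R,
     forall A : set R, measurable A -> P (Y @^-1` A) = \d_m A).

(* Finiteness of the mean and of the variance k x x is part of the definition:
   the expectation of a non-integrable function is infinite. *)
Record gaussian_process (R : realType) (dO : measure_display)
    (O : measurableType dO) (P : probability O R) (T : Type)
    (Z : T -> {RV P >-> R}) (m : T -> R) (k : T -> T -> R) : Prop := {
  gp_gaussian : forall (n : nat) (t : 'I_n -> T) (a : 'I_n -> R),
    gaussian_law P (fun w => \sum_(i < n) a i * Z (t i) w) ;
  gp_mean : forall x, ('E_P[Z x] = (m x)%:E)%E ;
  gp_cov : forall x y, covariance P (Z x) (Z y) = (k x y)%:E }.

Record iid_sample (R : realType) (dO dT : measure_display)
    (O : measurableType dO) (T : measurableType dT)
    (P : probability O R) (mu : probability T R)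
    (X : nat -> {RV P >-> T}) : Prop := {
  iid_law : forall i (A : set T), measurable A -> distribution P (X i) A = mu A ;
  iid_indep : forall (J : {fset nat}) (A : nat -> set T),
    (forall i, measurable (A i)) ->
    P (\bigcap_(i in [set` J]) X i @^-1` A i) =
      (\prod_(i <- J) P (X i @^-1` A i))%E }.

Definition dotL2 (R : realType) (dT : measure_display) (T : measurableType dT)
    (mu : probability T R) (f g : T -> R) : R :=
  \int[mu]_x (f x * g x).

Definition kernel_op (R : realType) (dT : measure_display)
    (T : measurableType dT) (mu : probability T R) (k : T -> T -> R)
    (f : T -> R) : T -> R :=
  fun x => \int[mu]_y (k x y * f y).

(* An orthonormal basis (e_i)_{i in I} of L^2_mu made of eigenfunctions, with
   T_{mu,k} e_i = nu_i e_i; I may be finite, as L^2_mu may be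
   finite-dimensional. *)
Record eigenbasis (R : realType) (dT : measure_display)
    (T : measurableType dT) (mu : probability T R) (k : T -> T -> R)
    (I : set nat) (e : nat -> T -> R) (nu : nat -> R) : Prop := {
  eb_L2 : forall i, I i -> e i \in Lfun mu 2%:E ;
  eb_orthonormal : forall i j, I i -> I j ->
    dotL2 mu (e i) (e j) = (i == j)%:R ;
  eb_basis : forall f : T -> R, f \in Lfun mu 2%:E ->
    ('N[mu]_2%:E[EFin \o (fun x =>
        f x - \sum_(i < n | (i : nat) \in I) dotL2 mu f (e i) * e i x)%R]
      @[n --> \oo] --> 0)%E ;
  eb_eigen : forall i, I i ->
    {ae mu, forall x, kernel_op mu k (e i) x = nu i * e i x} }.

(* A decreasing sequence indexed by nat lists the nonzero eigenvalues, each
   repeated according to its multiplicity, and continues with zeros if there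
   are finitely many of them; when there are infinitely many, a zero eigenvalue
   has no place in such a sequence. Hence the bijection between the nonzero
   entries of lambda and those of the spectrum of an eigenbasis. *)
Definition sorted_eigenvalues (R : realType) (dT : measure_display)
    (T : measurableType dT) (mu : probability T R) (k : T -> T -> R)
    (lambda : nat -> R) : Prop :=
  [/\ nonincreasing_seq lambda,
      forall p, 0 <= lambda p &
      exists (I : set nat) (e : nat -> T -> R) (nu : nat -> R) (s : nat -> nat),
        [/\ eigenbasis mu k I e nu,
            set_bij [set p | lambda p != 0] [set i | I i /\ nu i != 0] s &
            forall p, lambda p != 0 -> lambda p = nu (s p)]].

Definition nondegenerate_spectrum (R : realType) (lambda : nat -> R) : Prop :=
  forall p, 0 < lambda p.

Definition degenerate_spectrum (R : realType) (lambda : nat -> R) : Prop :=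
  finite_set [set p | lambda p != 0].

Definition kvec (R : realType) (T : Type) (k : T -> T -> R) (n : nat)
    (x : 'I_n -> T) (t : T) : 'cV[R]_n :=
  \col_i k t (x i).

Definition kmx (R : realType) (T : Type) (k : T -> T -> R) (n : nat)
    (x : 'I_n -> T) : 'M[R]_n :=
  \matrix_(i, j) k (x i) (x j).

(* Closed form of the mean squared error of the best linear unbiased predictor
   of Z t from the values Z (x i) observed with independent centered Gaussian
   noises of variance n * tau. *)
Definition sigma2 (R : realType) (T : Type) (k : T -> T -> R) (tau : R)
    (n : nat) (x : 'I_n -> T) (t : T) : R :=
  k t t - ((kvec k x t)^T *m invmx (kmx k x + (n%:R * tau)%:M)
             *m kvec k x t) ord0 ord0.

Definition IMSE (R : realType) (dT : measure_display) (T : measurableType dT)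
    (mu : probability T R) (k : T -> T -> R) (tau : R) (n : nat)
    (x : 'I_n -> T) : \bar R :=
  (\int[mu]_t (sigma2 k tau x t)%:E)%E.

Definition cvg_in_probability (R : realType) (dO : measure_display)
    (O : measurableType dO) (P : probability O R) (Y : nat -> O -> \bar R)
    (l : \bar R) : Prop :=
  forall e : R, 0 < e ->
    P [set w | (e%:E <= `| Y n w - l |)%E] @[n --> \oo] --> (0 : \bar R).

(* Main.v *)
Require Import Defs.
From HB Require Import structures.
From mathcomp Require Import all_boot all_order all_algebra finmap.
From mathcomp Require Import all_classical all_reals all_analysis.
From mathcomp Require Import measurable_realfun zify ring lra.
Import Order.TTheory GRing.Theory Num.Theory.
Import numFieldNormedType.Exports.
Local Open Scope classical_set_scope.
Local Open Scope ring_scope.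

(** Let phi_p be an everywhere defined eigenfunction for lambda_p and put
    A_p = n^-1 sum_i phi_p(x_i)^2 and
    V_p = n^-2 sum_(i, j) phi_p(x_i) phi_p(x_j) k(x_i, x_j). By the variational
    characterization of sigma^2, the suboptimal weights
    a_i(x) = n^-1 sum_(p < N) g_p phi_p(x) phi_p(x_i) give an upper bound of the
    IMSE in terms of the trace of k and of A_p, V_p for p < N; in the other
    direction, k - sum_(p < N) lambda_p phi_p(x) phi_p(y) is a positive kernel,
    which gives a lower bound in terms of A_p only. A strong law for
    V-statistics yields A_p -> 1 and V_p -> lambda_p almost surely. With
    g_p = lambda_p / (tau + lambda_p) the two bounds then differ in the limit by
    int k(x, x) dmu(x) - sum_(p < N) lambda_p, which tends to 0 because the trace
    of k is the sum of its eigenvalues. So the convergence is almost sure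
    whether or not the kernel is degenerate. *)

Set Implicit Arguments.
Unset Strict Implicit.
Unset Printing Implicit Defensive.

(** The inverse of the random matrix is never estimated: both bounds use only that [sigma2] is a
    minimum over weights. When the prediction point is integrated out, orthonormality removes all
    products of two different eigenfunctions, so no empirical Gram matrix appears. In the limit,
    index p contributes g^2 lambda_p + tau g^2 - 2 g lambda_p to the upper bound and 2 c - c^2 /
    lambda_p - c^2 / tau to the lower one; g_p and c_p = tau lambda_p / (tau + lambda_p) are the
    respective optimizers. The support of mu may be unbounded and an eigenfunction is only given up
    to null sets, so Mercer's expansion is replaced by two inequalities: the partial sums of
    lambda_p phi_p(t)^2 stay below k(t, t) at every t, and the integral of k(t, t) is at most the
    sum of the eigenvalues. As k is bounded, eigenfunctions of nonzero eigenvalue have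
    representatives bounded at every point; hence the calculus of bounded measurable functions
    below. *)

Definition bounded_measurable (R : realType) (d : measure_display)
    (T : measurableType d) (f : T -> R) : Prop :=
  measurable_fun [set: T] f /\ exists M : R, forall x, `|f x| <= M.

Arguments bounded_measurable {R d T} f.

(** * Bounded measurable functions under a probability measure *)

Section BoundedMeasurable.
Context {R : realType} {d : measure_display} {T : measurableType d}.
Implicit Types f g : T -> R.
Local Notation bm := bounded_measurable.

Lemma bm_cst (c : R) : bm (fun _ : T => c).
Proof. by split; [exact: measurable_cst | exists `|c|]. Qed.

Lemma bmD f g : bm f -> bm g -> bm (fun x => f x + g x).
Proof.
move=> [mf [M fM]] [mg [N gN]]; split; first exact: measurable_funD.
by exists (M + N) => x; rewrite (le_trans (ler_normD _ _))// lerD.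
Qed.

Lemma bmM f g : bm f -> bm g -> bm (fun x => f x * g x).
Proof.
move=> [mf [M fM]] [mg [N gN]]; split; first exact: measurable_funM.
by exists (M * N) => x; rewrite normrM ler_pM.
Qed.

Lemma bmZ c f : bm f -> bm (fun x => c * f x).
Proof. by apply: bmM; exact: bm_cst. Qed.

Lemma bmN f : bm f -> bm (fun x => - f x).
Proof.
by move=> [mf [M fM]]; split; [exact: measurable_funN | exists M => x; rewrite normrN].
Qed.

Lemma bmB f g : bm f -> bm g -> bm (fun x => f x - g x).
Proof. by move=> bf bg; apply: bmD => //; exact: bmN. Qed.

Lemma bmX f n : bm f -> bm (fun x => f x ^+ n).
Proof.
move=> bf; elim: n => [|n IH]; first exact: bm_cst.
by under eq_fun do rewrite exprS; exact: bmM.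
Qed.

Lemma bm_sum (I : Type) (r : seq I) (P : pred I) (F : I -> T -> R) :
  (forall i, P i -> bm (F i)) -> bm (fun x => \sum_(i <- r | P i) F i x).
Proof.
move=> bF; elim: r => [|i r IH].
  by under eq_fun do rewrite big_nil; exact: bm_cst.
under eq_fun do rewrite big_cons.
by case: (boolP (P i)) => Pi //; apply: bmD => //; exact: bF.
Qed.

Lemma bm_indic (A : set T) : measurable A -> bm (\1_A : T -> R).
Proof.
move=> mA; split; first exact: measurable_indic.
by exists 1 => x; rewrite indicE normr_nat lern1 leq_b1.
Qed.

Lemma bm_comp d' (T' : measurableType d') (h : T' -> T) f :
  measurable_fun setT h -> bm f -> bm (f \o h).
Proof.
move=> mh [mf [M fM]]; split; first exact: measurableT_comp.
by exists M => x; exact: fM.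
Qed.

End BoundedMeasurable.

Section BoundedIntegral.
Context {R : realType} {d : measure_display} {T : measurableType d}.
Variable mu : probability T R.
Implicit Types f g : T -> R.
Local Notation bm := bounded_measurable.

Lemma bm_integrable f : bm f -> mu.-integrable setT (EFin \o f).
Proof.
move=> [mf [M fM]]; apply: measurable_bounded_integrable => //.
  by rewrite (le_lt_trans (probability_le1 _ _))// ltry.
exists M; split; first exact: num_real.
by move=> N MN x _ /=; rewrite (le_trans (fM x))// ltW.
Qed.

Lemma bm_EFin_int f : bm f -> ((\int[mu]_x f x)%:E = \int[mu]_x (f x)%:E)%E.
Proof.
by move=> bf; rewrite /Rintegral fineK//; apply: integrable_fin_num => //;
  exact: bm_integrable.
Qed.

Lemma bm_intD f g : bm f -> bm g ->
  \int[mu]_x (f x + g x) = \int[mu]_x f x + \int[mu]_x g x.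
Proof. by move=> bf bg; apply: RintegralD => //; exact: bm_integrable. Qed.

Lemma bm_intB f g : bm f -> bm g ->
  \int[mu]_x (f x - g x) = \int[mu]_x f x - \int[mu]_x g x.
Proof. by move=> bf bg; apply: RintegralB => //; exact: bm_integrable. Qed.

Lemma bm_intZ c f : bm f -> \int[mu]_x (c * f x) = c * \int[mu]_x f x.
Proof. by move=> bf; apply: RintegralZl => //; exact: bm_integrable. Qed.

Lemma bm_intZr c f : bm f -> \int[mu]_x (f x * c) = \int[mu]_x f x * c.
Proof. by move=> bf; apply: RintegralZr => //; exact: bm_integrable. Qed.

Lemma prob_int_cst (c : R) : \int[mu]_x c = c.
Proof. rewrite (Rintegral_cst mu measurableT c).
rewrite -[RHS]mulr1; congr (c * _).
exact: (congr1 fine (probability_setT mu)). Qed.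

Lemma bm_int_sum (I : Type) (r : seq I) (P : pred I) (F : I -> T -> R) :
  (forall i, P i -> bm (F i)) ->
  \int[mu]_x (\sum_(i <- r | P i) F i x) = \sum_(i <- r | P i) \int[mu]_x F i x.
Proof.
move=> bF; elim: r => [|i r IH].
  rewrite big_nil -[RHS]prob_int_cst.
  by apply: eq_Rintegral => x _; rewrite big_nil.
rewrite big_cons -IH; under eq_Rintegral do rewrite big_cons.
case: (boolP (P i)) => Pi //; rewrite bm_intD//; first exact: bF.
exact: bm_sum.
Qed.

Lemma bm_int_le f g : bm f -> bm g -> (forall x, f x <= g x) ->
  \int[mu]_x f x <= \int[mu]_x g x.
Proof. by move=> bf bg fg; apply: le_Rintegral => //; exact: bm_integrable. Qed.

Lemma bm_int_norm f M : bm f -> (forall x, `|f x| <= M) -> `|\int[mu]_x f x| <= M.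
Proof.
move=> bf fM; rewrite (le_trans (le_normr_Rintegral _ (bm_integrable bf)))//.
rewrite -[leRHS]prob_int_cst; apply: bm_int_le => //; last exact: bm_cst.
by case: bf => mf [N fN]; split; [exact: measurableT_comp | exists N => x; rewrite normr_id].
Qed.

End BoundedIntegral.

Section BoundedFubini.
Context {R : realType} {d1 d2 : measure_display}.
Context {T1 : measurableType d1} {T2 : measurableType d2}.
Variables (m1 : probability T1 R) (m2 : probability T2 R).
Local Notation bm := bounded_measurable.
Variable F : T1 * T2 -> R.
Hypothesis bF : bm F.

Lemma bm_slice1 y : bm (fun x => F (x, y)).
Proof. exact: (@bm_comp _ _ _ _ _ (fun x => (x, y)) _ (pair2_measurable y) bF). Qed.

Lemma bm_slice2 x : bm (fun y => F (x, y)).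
Proof. exact: (@bm_comp _ _ _ _ _ (fun y => (x, y)) _ (pair1_measurable x) bF). Qed.

Let iF : (m1 \x m2)%E.-integrable setT (EFin \o F).
Proof.
exact: (@bm_integrable _ _ _ (m1 \x m2)%E).
Qed.

Lemma bm_fubini_F : bm (fun x => \int[m2]_y F (x, y)).
Proof.
split; last first.
  have [_ [M FM]] := bF; exists M => x.
  by apply: bm_int_norm => //; exact: bm_slice2.
by apply: (measurableT_comp (fine_measurable measurableT) (measurable_fubini_F iF)).
Qed.

Lemma bm_int_prod :
  \int[(m1 \x m2)%E]_z F z = \int[m1]_x \int[m2]_y F (x, y).
Proof.
apply: EFin_inj; rewrite (@bm_EFin_int _ _ _ (m1 \x m2)%E)//.
rewrite (bm_EFin_int _ bm_fubini_F).
under [RHS]eq_integral => x _ do rewrite (bm_EFin_int m2 (bm_slice2 x)).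
by rewrite (integral12_prod_meas1 iF).
Qed.

End BoundedFubini.

(** * Positive kernels and the variational form of the prediction error *)

Definition psd_kernel (R : realType) (T : Type) (k : T -> T -> R) : Prop :=
  (forall x y, k x y = k y x) /\
  forall (I : finType) (x : I -> T) (a : I -> R),
    0 <= \sum_i \sum_j a i * a j * k (x i) (x j).

(** Positivity for the concatenated family indexed by the disjoint sum [I + J]; this is why
    [psd_kernel] ranges over all finite index types. *)
Lemma psd_kernel_sum (R : realType) (T : Type) (k : T -> T -> R)
    (I J : finType) (x : I -> T) (y : J -> T) (a : I -> R) (b : J -> R) :
  psd_kernel k ->
  0 <= \sum_i \sum_j a i * a j * k (x i) (x j) +
       2 * (\sum_i \sum_j a i * b j * k (x i) (y j)) +
       \sum_i \sum_j b i * b j * k (y i) (y j).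
Proof.
move=> [k_sym k_ge0].
pose z (u : I + J) := match u with inl i => x i | inr j => y j end.
pose c (u : I + J) := match u with inl i => a i | inr j => b j end.
have := k_ge0 _ z c; rewrite big_sumType /=.
under eq_bigr do rewrite big_sumType /=.
under [X in _ + X]eq_bigr do rewrite big_sumType /=.
rewrite !big_split /= => h; apply: le_trans h _; rewrite le_eqVlt; apply/orP; left; apply/eqP.
have -> : \sum_i \sum_j b i * a j * k (y i) (x j) =
    \sum_i \sum_j a i * b j * k (x i) (y j).
  rewrite exchange_big; apply: eq_bigr => i _; apply: eq_bigr => j _.
  by rewrite k_sym [b j * _]mulrC.
by ring.
Qed.

Section Kriging.
Context {R : realType} {T : Type}.
Variables (k : T -> T -> R) (tau : R).
Hypotheses (k_psd : psd_kernel k) (tau_gt0 : 0 < tau).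
Variables (n : nat) (x : 'I_n -> T).

(** Mean squared error of the linear predictor of Z(t) with weights a_i on the noisy observations at
    x_i, the noise variance being n tau. *)
Definition predictor_risk (t : T) (a : 'I_n -> R) : R :=
  k t t - 2 * (\sum_i a i * k t (x i)) +
  \sum_i \sum_j a i * a j * k (x i) (x j) + n%:R * tau * \sum_i a i ^+ 2.

Let A : 'M[R]_n := kmx k x + (n%:R * tau)%:M.

Let quadE (v : 'cV[R]_n) : (v^T *m A *m v) 0 0 =
  \sum_i \sum_j v i 0 * v j 0 * k (x i) (x j) +
  n%:R * tau * \sum_i v i 0 ^+ 2.
Proof.
rewrite /A mulmxDr mulmxDl mxE; congr (_ + _).
  rewrite mxE exchange_big /=; apply: eq_bigr => j _.
  rewrite mxE big_distrl /=; apply: eq_bigr => i _.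
  by rewrite !mxE mulrAC.
rewrite mul_mx_scalar -scalemxAl mxE; congr (_ * _).
by rewrite mxE; apply: eq_bigr => i _; rewrite mxE expr2.
Qed.

Let quad_ge (v : 'cV[R]_n) :
  n%:R * tau * \sum_i v i 0 ^+ 2 <= (v^T *m A *m v) 0 0.
Proof. by rewrite quadE lerDr; exact: k_psd.2. Qed.

Let A_sym : A^T = A.
Proof.
by rewrite /A linearD /= tr_scalar_mx; congr (_ + _);
  apply/matrixP => i j; rewrite !mxE k_psd.1.
Qed.

Lemma kmx_unit : kmx k x + (n%:R * tau)%:M \in unitmx.
Proof.
rewrite -/A.
rewrite -row_free_unit; apply/inj_row_free => v vA.
(* For n = 0 the factor n tau vanishes and [quad_ge] says nothing, but then v has no coordinates. *)
have [n0|n_gt0] := posnP n.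
  by apply/rowP => i; have := ltn_ord i; rewrite {2}n0.
have := quad_ge v^T; rewrite trmxK vA mul0mx mxE => h.
have {h} : \sum_i v^T i 0 ^+ 2 <= 0.
  by rewrite -(@pmulr_rle0 _ (n%:R * tau))// mulr_gt0// ltr0n.
rewrite le_eqVlt ltNge sumr_ge0 ?orbF; last by move=> i _; exact: sqr_ge0.
rewrite psumr_eq0; last by move=> i _; exact: sqr_ge0.
move=> /allP v0; apply/rowP => i; have /= := v0 i (mem_index_enum _).
by rewrite sqrf_eq0 !mxE => /eqP ->.
Qed.

(** Completing the square around the optimal weights A^-1 k(t). As A is positive, [sigma2] is the
    minimum of the risk. *)
Let riskE (t : T) (v : 'cV[R]_n) : predictor_risk t (fun i => v i 0) =
  sigma2 k tau x t +
  ((v - invmx A *m kvec k x t)^T *m A *m (v - invmx A *m kvec k x t)) 0 0.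
Proof.
set b := kvec k x t; rewrite /sigma2 -/A -/b.
have Ab : A *m (invmx A *m b) = b by rewrite (mulKVmx kmx_unit).
have bA : (invmx A *m b)^T *m A = b^T by rewrite -[X in _ *m X]A_sym -trmx_mul Ab.
set c := invmx A *m b in Ab bA *.
have subE (M N : 'M[R]_1) : (M - N) 0 0 = M 0 0 - N 0 0 by rewrite !mxE.
have -> : b^T *m invmx A *m b = b^T *m c by rewrite mulmxA.
rewrite [(v - c)^T]raddfB /= mulmxBr !mulmxBl bA !subE -(mulmxA _ A c) Ab.
have -> : (v^T *m b) 0 0 = \sum_i v i 0 * k t (x i).
  by rewrite mxE; apply: eq_bigr => i _; rewrite !mxE.
have -> : (b^T *m v) 0 0 = \sum_i v i 0 * k t (x i).
  by rewrite mxE; apply: eq_bigr => i _; rewrite !mxE mulrC.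
by rewrite quadE /predictor_risk; ring.
Qed.

Lemma sigma2_le t a : sigma2 k tau x t <= predictor_risk t a.
Proof.
have -> : a = (fun i => (\col_i a i) i 0) by apply/funext => i; rewrite mxE.
rewrite riskE lerDl; apply: le_trans (quad_ge _).
rewrite !mulr_ge0 ?ler0n ?(ltW tau_gt0)// sumr_ge0// => i _; exact: sqr_ge0.
Qed.

Lemma sigma2_attained t : exists a, sigma2 k tau x t = predictor_risk t a.
Proof.
exists (fun i => (invmx A *m kvec k x t) i 0).
by rewrite riskE subrr mulmx0 mxE addr0.
Qed.

(** At the optimal weights the risk is the kernel form at t and the x_i with weights 1 and -a_i,
    plus a nonnegative noise term. *)
Lemma sigma2_ge0 t : 0 <= sigma2 k tau x t.
Proof.
have [a ->] := sigma2_attained t; rewrite /predictor_risk.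
have nt : 0 <= n%:R * tau * \sum_i a i ^+ 2.
  rewrite !mulr_ge0 ?ler0n ?(ltW tau_gt0)// sumr_ge0// => i _; exact: sqr_ge0.
rewrite addr_ge0//.
have := psd_kernel_sum (fun _ : 'I_1 => t) x (fun=> 1) (fun i => - a i) k_psd.
rewrite !big_ord1 !mul1r => h; apply: le_trans h _; rewrite le_eqVlt; apply/orP; left; apply/eqP.
under eq_bigr do rewrite mul1r mulNr.
under [X in _ + X]eq_bigr do under eq_bigr do rewrite mulrNN.
by rewrite !sumrN; ring.
Qed.

Lemma sigma2_le_var t : sigma2 k tau x t <= k t t.
Proof.
apply: le_trans (sigma2_le t (fun=> 0)) _; rewrite /predictor_risk.
rewrite big1 ?mulr0 ?subr0; last by move=> i _; rewrite mul0r.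
rewrite big1 ?addr0; last by move=> i _; rewrite big1// => j _; rewrite !mul0r.
by rewrite big1 ?mulr0 ?addr0// => i _; rewrite expr0n.
Qed.

End Kriging.

(** * Expectations of functions of one or two sample points *)

Lemma Rintegral_pushforward (R : realType) d d' (O : measurableType d)
    (T : measurableType d') (P : probability O R) (m : probability T R)
    (Y : {RV P >-> T}) (f : T -> R) :
  (forall A, measurable A -> m A = P (Y @^-1` A)) -> bounded_measurable f ->
  \int[P]_w f (Y w) = \int[m]_x f x.
Proof.
move=> mE bf; rewrite /Rintegral; congr fine; apply/esym.
transitivity (\int[distribution P Y]_x (f x)%:E)%E.
  by apply: eq_measure_integral => A mA _; exact: mE.
rewrite (@integral_distribution _ _ _ _ _ _ Y (EFin \o f))//.
  by apply/measurable_EFinP; exact: bf.1.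
apply: (@bm_integrable _ _ _ P (f \o Y)); apply: bm_comp => //.
Qed.

Section IidExpectation.
Context {R : realType} {dO dT : measure_display}.
Context {O : measurableType dO} {T : measurableType dT}.
Variables (P : probability O R) (mu : probability T R).
Variables (X : nat -> {RV P >-> T}) (X_iid : iid_sample mu X).
Local Notation bm := bounded_measurable.

Lemma iid_int1 i (f : T -> R) : bm f -> \int[P]_w f (X i w) = \int[mu]_x f x.
Proof.
by apply: Rintegral_pushforward => A mA; rewrite -(iid_law X_iid i mA).
Qed.

Definition pairRV (i j : nat) (w : O) : T * T := (X i w, X j w).

Lemma measurable_pairRV i j : measurable_fun setT (pairRV i j).
Proof. by apply/measurable_fun_pairP; split; apply: measurable_funP. Qed.

HB.instance Definition _ i j :=
  isMeasurableFun.Build _ _ _ _ (pairRV i j) (measurable_pairRV i j).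

(** The joint law of two distinct sample points is the product of mu with itself, since both
    measures agree on rectangles. *)
Lemma iid_int2 i j (F : T * T -> R) : i != j -> bm F ->
  \int[P]_w F (X i w, X j w) = \int[mu]_x \int[mu]_y F (x, y).
Proof.
move=> ij bF; rewrite -bm_int_prod//.
apply: (@Rintegral_pushforward _ _ _ _ _ _ (mu \x mu)%E (pairRV i j)) => // A mA.
apply: (product_measure_unique (m' := distribution P (pairRV i j))) => // {mA}A B mA mB.
(* [iid_indep] wants a family of sets indexed by all of nat; only its values at i and j matter. *)
have mC l : measurable (if l == i then A else B) by case: ifP.
have := iid_indep X_iid [fset i; j]%fset mC.
rewrite big_fsetU1 ?inE//= big_seq_fset1 eqxx eq_sym (negbTE ij).
rewrite -(iid_law X_iid i mA) -(iid_law X_iid j mB) => <-.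
rewrite /distribution /pushforward; congr (P _).
apply/seteqP; split => w /=.
  move=> [Aw Bw] l /=; rewrite !inE => /orP[/eqP ->|/eqP ->].
    by rewrite eqxx.
  by rewrite eq_sym (negbTE ij).
move=> h; split.
  by have := h i; rewrite eqxx; apply; rewrite /= !inE eqxx.
by have := h j; rewrite eq_sym (negbTE ij); apply; rewrite /= !inE eqxx orbT.
Qed.

End IidExpectation.

(** * A strong law for nonnegative V-statistics *)

Lemma nat_sqrt_exists (n : nat) :
  exists s, (s * s <= n)%N /\ (n < s.+1 * s.+1)%N.
Proof.
elim: n => [|n [s [s1 s2]]]; first by exists 0%N.
have [h|h] := leqP (s.+1 * s.+1) n.+1.
  by exists s.+1; split => //; rewrite (leq_ltn_trans s2)// ltn_mul.
by exists s; split => //; rewrite (leq_trans s1).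
Qed.

Section VStatistic.
Context {R : realType}.
Variables (g : nat -> nat -> R) (C : R).
Hypotheses (g_bound : forall i j, `|g i j| <= C).

Definition vsum (n : nat) : R := \sum_(i < n) \sum_(j < n) g i j.

Hypothesis vsum_ge0 : forall n, 0 <= vsum n.

(** Enlarging the index square from m to n adds n^2 - m^2 entries, each at most C. *)
Lemma vsum_leD m n : (m <= n)%N -> vsum n <= vsum m + C * (n%:R ^+ 2 - m%:R ^+ 2).
Proof.
move=> mn; rewrite -(subnK mn); elim: (n - m)%N => [|l IH].
  by rewrite add0n subrr mulr0 addr0.
rewrite addSn; set p := (l + m)%N in IH *.
have -> : vsum p.+1 = vsum p + (\sum_(i < p) g i p + \sum_(j < p) g p j + g p p).
  rewrite /vsum big_ord_recr /= big_ord_recr /=.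
  under eq_bigr do rewrite big_ord_recr /=.
  by rewrite big_split /= !addrA.
have b (h : 'I_p -> R) : (forall i, h i <= C) -> \sum_i h i <= p%:R * C.
  move=> hC; apply: le_trans (ler_sum _ (fun i _ => hC i)) _.
  by rewrite sumr_const card_ord mulr_natl.
have gC i j : g i j <= C by rewrite (le_trans (ler_norm _)).
have b1 := b (fun i => g i p) (fun i => gC i p).
have b2 := b (fun i => g p i) (fun i => gC p i).
have b3 := gC p p.
move: IH b1 b2 b3; rewrite -natr1; move: (vsum p) (\sum_i _) (\sum_i _) => a b0 c0.
by move=> *; nra.
Qed.

(* Between consecutive squares s^2 <= n < (s+1)^2 the sum grows by at most
   C (n^2 - s^4), which is negligible with respect to n^2. *)
Lemma vsum_cvg_squares :
  (fun s => vsum (s * s) / (s * s)%:R ^+ 2) @ \oo --> (0 : R) ->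
  (fun n => vsum n / n%:R ^+ 2) @ \oo --> (0 : R).
Proof.
move=> h; apply/cvgrPdist_lt => e e0.
have C0 : 0 <= C by apply: le_trans (g_bound 0 0).
have e2 : 0 < e / 2 by rewrite divr_gt0.
move/cvgrPdist_lt : h => /(_ _ e2) [M _ hM].
(* For s >= 16 C / e and n >= s^2, the increment, at most 6 C s n, is below (e / 2) n^2; 12 in place
   of 16 would be the sharp constant. *)
have [K hK] : exists K : nat, 16 * C / e < K%:R.
  by exists (Num.bound (16 * C / e)); apply: archi_boundP; rewrite divr_ge0 ?mulr_ge0 ?(ltW e0).
exists ((M + K).+1 * (M + K).+1)%N => // n /= Hn.
have [s [s1 s2]] := nat_sqrt_exists n.
have Ms : (M + K < s.+1)%N by move: Hn s2; nia.
have s0 : (0 < s)%N by move: Hn s2; nia.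
have n0 : (0 < n)%N by move: Hn; nia.
have nR : 0 < (n%:R : R) by rewrite ltr0n.
have sR : 0 < (s%:R : R) by rewrite ltr0n.
have s1R : 1 <= (s%:R : R) by rewrite ler1n.
have := hM s; rewrite /= => /(_ _)/wrap[]; first lia.
rewrite !sub0r !normrN !ger0_norm ?divr_ge0 ?sqr_ge0// => hs.
have sn : (s%:R * s%:R <= (n%:R : R)) by rewrite -natrM ler_nat.
have nsS : (n%:R : R) <= (s%:R + 1) * (s%:R + 1).
  by rewrite natr1 -natrM ler_nat ltnW.
have sK : 16 * C / e < (s%:R : R) by apply: lt_le_trans hK _; rewrite ler_nat; lia.
rewrite ltr_pdivrMr; last by rewrite exprn_gt0.
apply: le_lt_trans (vsum_leD s1) _.
rewrite ltr_pdivrMr in hs; last by rewrite exprn_gt0// natrM mulr_gt0.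
rewrite ltr_pdivrMr// in sK.
move: hs sn nsS sK; rewrite natrM.
move: (vsum _) (n%:R : R) (s%:R : R) nR sR s1R => v nn ss nR sR s1R hs sn nsS sK.
have h1 : e / 2 * (ss * ss) ^+ 2 <= e / 2 * nn ^+ 2.
  by rewrite ler_pM2l// ler_sqr ?nnegrE ?mulr_ge0// ltW.
(* From n <= (s + 1)^2 and s >= 1: n - s^2 <= 2 s + 1 <= 3 s. *)
have nd : nn - ss * ss <= 3 * ss by nra.
have h2 : C * (nn ^+ 2 - (ss * ss) ^+ 2) <= 6 * C * ss * nn.
  have -> : nn ^+ 2 - (ss * ss) ^+ 2 = (nn - ss * ss) * (nn + ss * ss) by ring.
  have : (nn - ss * ss) * (nn + ss * ss) <= (3 * ss) * (2 * nn).
    by apply: ler_pM => //; nra.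
  by move=> /(ler_wpM2l C0) h2; apply: le_trans h2 _; rewrite le_eqVlt; apply/orP; left; apply/eqP; ring.
have h3 : 6 * C * ss * nn <= e / 2 * nn ^+ 2.
  have h4 : 16 * C * ss <= e * (ss * ss) by rewrite mulrA [e * ss]mulrC; apply: ler_wpM2r; exact: ltW.
  have h5 : e * (ss * ss) <= e * nn by rewrite ler_pM2l.
  have h6 : 16 * C * ss * nn <= e * nn * nn by apply: ler_wpM2r; [exact: ltW | exact: le_trans h4 h5].
  have : 0 <= C * ss * nn by rewrite !mulr_ge0// ltW.
  by rewrite expr2; nra.
by nra.
Qed.
End VStatistic.

Section VStatisticSLLN.
Context {R : realType} {dO dT : measure_display}.
Context {O : measurableType dO} {T : measurableType dT}.
Variables (P : probability O R) (mu : probability T R).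
Variables (X : nat -> {RV P >-> T}) (X_iid : iid_sample mu X).
Local Notation bm := bounded_measurable.
Variable F : T * T -> R.
Hypothesis bF : bm F.
Hypothesis F_centered : \int[mu]_x \int[mu]_y F (x, y) = 0.
Hypothesis F_pos : forall n (x : 'I_n -> T), 0 <= \sum_i \sum_j F (x i, x j).

Let S n w := vsum (fun i j => F (X i w, X j w)) n.

Let bF2 i j : bm (fun w => F (X i w, X j w)).
Proof. exact: (bm_comp (measurable_pairRV X i j) bF). Qed.

Let bS n : bm (S n).
Proof. by apply: bm_sum => i _; apply: bm_sum => j _; exact: bF2. Qed.

Let S_ge0 n w : 0 <= S n w.
Proof. exact: (F_pos (fun i : 'I_n => X i w)). Qed.

(** The off-diagonal terms have expectation 0 because F is centered under the product of mu with
    itself; only the n diagonal terms remain. *)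
Let int_S n (C : R) : (forall z, `|F z| <= C) -> \int[P]_w S n w <= n%:R * C.
Proof.
move=> FC; rewrite bm_int_sum; last by move=> i _; apply: bm_sum => j _.
have E (i : 'I_n) : \int[P]_w (\sum_(j < n) F (X i w, X j w)) <= C.
  rewrite bm_int_sum// (bigD1 i)//= big1 ?addr0.
    apply: le_trans (ler_norm _) _; apply: bm_int_norm => // w; exact: FC.
  move=> j ji; rewrite (iid_int2 X_iid) ?F_centered//.
  by apply: contra ji => /eqP/val_inj ->.
apply: le_trans (ler_sum _ (fun i _ => E i)) _.
by rewrite sumr_const card_ord mulr_natl.
Qed.

(** Restriction to squares: by [int_S] the expectations are at most C / (m + 1)^2, which is
    summable, whereas along all n the bound would only be C / n. *)
Let u m w : R := S (m.+1 * m.+1) w / (m.+1 * m.+1)%:R ^+ 2.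

Let bu m : bm (u m).
Proof. by apply: bmM => //; exact: bm_cst. Qed.

Let u_ge0 m w : 0 <= u m w.
Proof. by rewrite divr_ge0// sqr_ge0. Qed.

(* 1/(m+1)^2 <= 2/(m+1) - 2/(m+2) *)
Let sum_int_u (C : R) N : (forall z, `|F z| <= C) ->
  \sum_(0 <= m < N) \int[P]_w u m w <= C * (2 - 2 / N.+1%:R).
Proof.
move=> FC; have C0 : 0 <= C by apply: le_trans (FC (X 0 point, X 0 point)).
elim: N => [|N IH]; first by rewrite big_nil divr1 subrr mulr0.
rewrite big_nat_recr//=; apply: le_trans (lerD IH (lexx _)) _.
have : \int[P]_w u N w <= C / N.+1%:R ^+ 2.
  rewrite bm_intZr// ler_pdivrMr ?exprn_gt0 ?ltr0n//.
  apply: le_trans (int_S _ FC) _; rewrite natrM.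
  by rewrite le_eqVlt; apply/orP; left; apply/eqP; field.
move=> h; apply: le_trans (lerD (lexx _) h) _.
rewrite -mulrDr ler_wpM2l// -[N.+2%:R]natr1.
have : 1 <= (N.+1%:R : R) by rewrite ler1n.
move: (N.+1%:R : R) => t t1.
rewrite -subr_ge0.
have -> : 2 - 2 / (t + 1) - (2 - 2 / t + t ^- 2) = (t - 1) / (t ^+ 2 * (t + 1)).
  by field; apply/andP; split; nra.
by rewrite divr_ge0//; nra.
Qed.

(** Because the sums are nonnegative, first moments suffice: the series of the [u m] has finite
    expectation, so it converges almost surely and its terms tend to 0. [vsum_cvg_squares] then
    fills in the indices between squares. *)
Lemma vstat_slln :
  {ae P, forall w, (fun n => vsum (fun i j => F (X i w, X j w)) n / n%:R ^+ 2)
     @ \oo --> (0 : R)}.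
Proof.
have [_ [C FC]] := bF.
have mu_ m : measurable_fun setT (fun w => (u m w)%:E).
  by apply/measurable_EFinP; exact: (bu m).1.
have int_fin : (\int[P]_w (\sum_(0 <= m <oo) (u m w)%:E) < +oo)%E.
  rewrite integral_nneseries//; last by move=> m w _; rewrite lee_fin.
  apply: (@le_lt_trans _ _ (C * 2)%:E); last by rewrite ltry.
  apply: lime_le.
    by apply: is_cvg_nneseries => m _ _; apply: integral_ge0 => w _; rewrite lee_fin.
  near=> N; rewrite -(eq_bigr _ (fun m _ => bm_EFin_int P (bu m))) sumEFin lee_fin.
  apply: le_trans (sum_int_u N FC) _; apply: ler_wpM2l.
    by apply: le_trans (FC (X 0 point, X 0 point)).
  by rewrite lerBlDr lerDl divr_ge0.
have mS : measurable_fun setT (fun w => \sum_(0 <= m <oo) (u m w)%:E)%E.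
  by apply: ge0_emeasurable_sum => // m w _ _; rewrite lee_fin.
have iS : P.-integrable setT (fun w => \sum_(0 <= m <oo) (u m w)%:E)%E.
  apply/integrableP; split => //; apply: le_lt_trans int_fin.
  under eq_integral => w _.
    rewrite gee0_abs; last by apply: nneseries_ge0 => m _ _; rewrite lee_fin.
    over.
  by [].
have := integrable_ae measurableT iS; apply: filterS => w /(_ I) fin.
apply: (@vsum_cvg_squares _ _ C) => //.
  by move=> n; exact: S_ge0.
rewrite -(cvg_shiftS (fun s => _)) /=.
have : cvgn (series (fun m => u m w)).
  apply: nondecreasing_is_cvgn.
    by apply/nondecreasing_seqP => n; rewrite /series /= big_nat_recr//= lerDl.
  exists (fine (\sum_(0 <= m <oo) (u m w)%:E)%E) => _ [n _ <-].
  rewrite -lee_fin fineK// /series /= -sumEFin.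
  by apply: nneseries_lim_ge => m _; rewrite lee_fin.
by move/cvg_series_cvg_0.
Unshelve. all: by end_near. Qed.

End VStatisticSLLN.

(** * Positivity against signed measures and pointwise spectral bounds *)

Section SignedPositivity.
Context {R : realType} {dO dT : measure_display}.
Context {O : measurableType dO} {T : measurableType dT}.
Variables (P : probability O R) (mu : probability T R).
Variables (X : nat -> {RV P >-> T}) (X_iid : iid_sample mu X).
Local Notation bm := bounded_measurable.
Variable k : T -> T -> R.
Hypotheses (bk : bm (fun z => k z.1 z.2)) (k_psd : psd_kernel k).

Let bkX x : bm (k x).
Proof. exact: (bm_slice2 bk x). Qed.

(* Positivity of k for the signed measure sum_i w_i delta_(z_i) - g mu, where mu
   is replaced by the empirical measure of an M-sample before M tends to
   infinity. *)
Lemma psd_signed n (z : 'I_n -> T) (w : 'I_n -> R) (g : T -> R) : bm g ->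
  0 <= \sum_i \sum_j w i * w j * k (z i) (z j) -
       2 * (\sum_i w i * \int[mu]_y (k (z i) y * g y)) +
       \int[mu]_x \int[mu]_y (g x * g y * k x y).
Proof.
move=> bg; set Q := (X in X - _); set B := (\sum_i w i * _).
pose F (u : T * T) := g u.1 * g u.2 * k u.1 u.2.
have bF : bm F.
  apply: bmM => //; apply: bmM.
    exact: (bm_comp (@measurable_fst _ _ T T) bg).
  exact: (bm_comp (@measurable_snd _ _ T T) bg).
set I := Rintegral _ _ _; have [_ [C FC]] := bF.
have IF : \int[mu]_x \int[mu]_y F (x, y) = I by [].
(* Expectation of the kernel form at the z_i with weights w_i and at M + 1 sample points with
   weights -g(X_j) / (M + 1). The diagonal pairs of sample points do not follow the product law;
   they cost at most (C + |I|) / (M + 1). *)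
have key M : 0 <= Q - 2 * B + I + (C + `|I|) / M.+1%:R.
  pose m : R := M.+1%:R.
  have m0 : m != 0 by rewrite pnatr_eq0.
  have mp : 0 < m by rewrite ltr0n.
  pose H om := Q - 2 / m * (\sum_i w i * (\sum_(j < M.+1) k (z i) (X j om) * g (X j om))) +
    m ^- 2 * (\sum_(j < M.+1) \sum_(l < M.+1) F (X j om, X l om)).
  have H0 om : 0 <= H om.
    have := psd_kernel_sum z (fun j : 'I_M.+1 => X j om) w (fun j => - g (X j om) / m) k_psd.
    move=> h; apply: le_trans h _; rewrite le_eqVlt; apply/orP; left; apply/eqP.
    rewrite /H; congr (_ + _ + _).
      rewrite -mulrA -mulrN; congr (_ * _).
      rewrite big_distrr -sumrN /=; apply: eq_bigr => i _.
      rewrite 2!big_distrr -sumrN /=; apply: eq_bigr => j _.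
      by field.
    rewrite big_distrr /=; apply: eq_bigr => i _.
    rewrite big_distrr /=; apply: eq_bigr => j _.
    by rewrite /F /=; field.
  have bX (j : nat) (h : T -> R) : bm h -> bm (fun om => h (X j om)).
    by move=> bh; apply: (bm_comp (h := X j)).
  have b1 i : bm (fun om => w i * (\sum_(j < M.+1) k (z i) (X j om) * g (X j om))).
    apply: bmZ; apply: bm_sum => j _; apply: bmM; first exact: (bX j (k (z i))).
    exact: bX.
  have b2 (j l : nat) : bm (fun om => F (X j om, X l om)).
    exact: (bm_comp (measurable_pairRV X j l) bF).
  have b3 (j : 'I_M.+1) : bm (fun om => \sum_(l < M.+1) F (X j om, X l om)).
    by apply: bm_sum => l _; exact: b2.
  have b4 : bm (fun om => \sum_i w i * (\sum_(j < M.+1) k (z i) (X j om) * g (X j om))).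
    by apply: bm_sum => i _; exact: b1.
  have b5 : bm (fun om => \sum_(j < M.+1) \sum_(l < M.+1) F (X j om, X l om)).
    by apply: bm_sum => i _; exact: b3.
  have : 0 <= \int[P]_om H om by apply: Rintegral_ge0.
  rewrite bm_intD; [|by apply: bmB; [exact: bm_cst|exact: bmZ]|exact: bmZ].
  rewrite bm_intB; [|exact: bm_cst|exact: bmZ].
  rewrite prob_int_cst !bm_intZ// !bm_int_sum//.
  have -> : \sum_i \int[P]_x (w i * (\sum_(j < M.+1) k (z i) (X j x) * g (X j x))) = m * B.
    rewrite big_distrr; apply: eq_bigr => i _ /=.
    have bkg : bm (fun y => k (z i) y * g y) by apply: bmM.
    rewrite bm_intZ; last by apply: bm_sum => j _; exact: (bX j _ bkg).
    rewrite bm_int_sum; last by move=> j _; exact: (bX j _ bkg).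
    under eq_bigr do rewrite (iid_int1 X_iid _ bkg).
    by rewrite sumr_const card_ord -mulr_natl mulrCA.
  (* A row has one diagonal term, at most C, and M terms equal to I; since m = M + 1, the difference
     -I is absorbed by |I|. *)
  have hrow (j : 'I_M.+1) : \int[P]_x (\sum_(l < M.+1) F (X j x, X l x)) <= m * I + (C + `|I|).
    rewrite bm_int_sum// (bigD1 j)//=.
    have -> : \sum_(l < M.+1 | l != j) \int[P]_x F (X j x, X l x) = \sum_(l < M.+1 | l != j) I.
      by apply: eq_bigr => l lj; rewrite (iid_int2 X_iid)// eq_sym.
    rewrite sumr_const cardC1 card_ord -pred_Sn.
    have h1 : \int[P]_x F (X j x, X j x) <= C.
      by apply: le_trans (ler_norm _) _; apply: bm_int_norm => // x; exact: FC.
    have := ler_norm (- I); rewrite normrN -[I *+ M]mulr_natl /m -natr1 => h2.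
    by move: h1 h2; move: (`|I|) (M%:R : R) => a b; nra.
  move=> h; have := ler_sum (index_enum _) (fun (j : 'I_M.+1) (_ : true) => hrow j).
  rewrite sumr_const card_ord -[X in _ <= X]mulr_natl -/m.
  move: h; set V := \sum_(i < M.+1) _ => h hV.
  have {}hV : m ^- 2 * V <= m ^- 2 * (m * (m * I + (C + `|I|))).
    by rewrite ler_wpM2l// invr_ge0 sqr_ge0.
  have e1 : m ^- 2 * (m * (m * I + (C + `|I|))) = I + (C + `|I|) / m by field.
  have e2 : 2 / m * (m * B) = 2 * B by field.
  by move: h hV; rewrite e1 e2; move: (m ^- 2 * V) (_ / m) => a b; lra.
rewrite leNgt; apply/negP => neg.
have C0 : 0 <= C + `|I| by rewrite addr_ge0// (le_trans _ (FC (X 0 point, X 0 point))).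
set q := Q - 2 * B + I in key neg *.
have nq : 0 < - q by rewrite oppr_gt0.
(* With this M the error term of [key] is smaller than -q, a contradiction. *)
pose M := Num.bound ((C + `|I|) / - q).
have : (C + `|I|) / - q < M%:R by apply: archi_boundP; rewrite divr_ge0// ltW.
rewrite ltr_pdivrMr// => hM.
have := key M; have Mp : 0 < (M.+1%:R : R) by rewrite ltr0n.
rewrite -(pmulr_lge0 _ Mp) mulrDl divfK ?gt_eqF// -natr1.
have : 0 <= (M%:R : R) by rewrite ler0n.
by move: hM; move: (M%:R : R) (C + _) => a b; nra.
Qed.

End SignedPositivity.

Section Spectral.
Context {R : realType} {dO dT : measure_display}.
Context {O : measurableType dO} {T : measurableType dT}.
Variables (P : probability O R) (mu : probability T R).
Variables (X : nat -> {RV P >-> T}) (X_iid : iid_sample mu X).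
Local Notation bm := bounded_measurable.
Variable k : T -> T -> R.
Hypotheses (bk : bm (fun z => k z.1 z.2)) (k_psd : psd_kernel k).
Variables (lambda : nat -> R) (phi : nat -> T -> R).
Hypothesis lambda_ge0 : forall p, 0 <= lambda p.
Hypothesis bphi : forall p, bm (phi p).
(** The indices with lambda_p = 0 are padding without an eigenfunction: phi_p then has norm 0
    instead of 1. Hence the conditions below that coefficients vanish together with lambda_p. *)
Hypothesis phi_ortho : forall p q,
  \int[mu]_x (phi p x * phi q x) = ((p == q) && (lambda p != 0))%:R.
Hypothesis phi_eigen : forall p x,
  \int[mu]_y (k x y * phi p y) = lambda p * phi p x.

Let bkX x : bm (k x).
Proof. exact: (bm_slice2 bk x). Qed.

Let bkd : bm (fun t => k t t).
Proof.
apply: (bm_comp (h := fun t => (t, t)) _ bk).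
by apply/measurable_fun_pairP; split; exact: measurable_id.
Qed.

Lemma int_phi_sum N (a b : nat -> R) : (forall p, lambda p = 0 -> a p = 0) ->
  \int[mu]_x ((\sum_(p < N) a p * phi p x) * (\sum_(q < N) b q * phi q x)) =
  \sum_(p < N) a p * b p.
Proof.
move=> a0; under eq_Rintegral do rewrite big_distrl /=.
rewrite bm_int_sum; last first.
  by move=> p _; apply: bmM; [exact: bmZ | apply: bm_sum => q _; exact: bmZ].
apply: eq_bigr => p _; under eq_Rintegral do rewrite big_distrr /=.
rewrite bm_int_sum; last by move=> q _; apply: bmM; exact: bmZ.
have E (q : 'I_N) : \int[mu]_x (a p * phi p x * (b q * phi q x)) =
    a p * b q * ((p == q) && (lambda p != 0))%:R.
  rewrite -phi_ortho -bm_intZ; last exact: bmM.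
  by apply: eq_Rintegral => x _; rewrite mulrACA.
rewrite (bigD1 p)//= E eqxx big1 ?addr0; last first.
  by move=> q qp; rewrite E eq_sym (negbTE qp) mulr0.
by case: eqP => [/a0 ->|_]; rewrite ?mul0r ?mulr1.
Qed.

Lemma int_kernel_phi_sum N (b : nat -> R) x :
  \int[mu]_y (k x y * (\sum_(p < N) b p * phi p y)) =
  \sum_(p < N) b p * lambda p * phi p x.
Proof.
under eq_Rintegral do rewrite big_distrr /=.
rewrite bm_int_sum; last by move=> p _; apply: bmM => //; exact: bmZ.
apply: eq_bigr => p _; rewrite -mulrA -phi_eigen -bm_intZ; last exact: bmM.
by apply: eq_Rintegral => y _; rewrite mulrCA.
Qed.

(** [psd_signed] with g = sum_(p < N) b_p phi_p, the density whose coefficients are those of the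
    point masses. The mixed term and the double integral are then both s = sum_p lambda_p b_p^2, so
    the form minus 2 s plus s is nonnegative. *)
Lemma psd_spectral N n (z : 'I_n -> T) (w : 'I_n -> R) :
  \sum_(p < N) lambda p * (\sum_i w i * phi p (z i)) ^+ 2 <=
  \sum_i \sum_j w i * w j * k (z i) (z j).
Proof.
pose b (p : nat) := \sum_i w i * phi p (z i).
(* Coefficients at padding indices are cleared so that [int_phi_sum] applies; the products lambda_p
   b_p are unaffected. *)
pose b' (p : nat) := if lambda p == 0 then 0 else b p.
pose g x := \sum_(p < N) b' p * phi p x.
have bg : bm g by apply: bm_sum => p _; exact: bmZ.
have lb p : b' p * lambda p = lambda p * b p.
  by rewrite /b'; case: eqP => [->|_]; rewrite ?mul0r// mulrC.
have := psd_signed X_iid bk k_psd z w bg.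
have -> : \sum_i w i * \int[mu]_y (k (z i) y * g y) = \sum_(p < N) lambda p * b p ^+ 2.
  under eq_bigr do rewrite int_kernel_phi_sum big_distrr /=.
  rewrite exchange_big /=; apply: eq_bigr => p _.
  rewrite expr2 {2}/b big_distrr /= big_distrr /=.
  by apply: eq_bigr => i _; rewrite lb; ring.
have -> : \int[mu]_x \int[mu]_y (g x * g y * k x y) = \sum_(p < N) lambda p * b p ^+ 2.
  transitivity (\int[mu]_x (g x * (\sum_(p < N) (lambda p * b p) * phi p x))).
    apply: eq_Rintegral => x _.
    under eq_Rintegral => y _ do rewrite -mulrA [g y * _]mulrC.
    rewrite bm_intZ; last by apply: bmM.
    by rewrite int_kernel_phi_sum; under eq_bigr do rewrite lb.
  rewrite (@int_phi_sum N b' (fun p => lambda p * b p)); last first.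
    by move=> p l0; rewrite /b' l0 eqxx.
  by apply: eq_bigr => p _; rewrite mulrA lb expr2 mulrA.
by lra.
Qed.

(** At a single point t, [psd_spectral] gives sum_p lambda_p phi_p(t)^2 <= k(t, t), which is then
    integrated. *)
Lemma sum_eigen_le_trace N : \sum_(p < N) lambda p <= \int[mu]_t k t t.
Proof.
have bl p : bm (fun t => lambda p * phi p t ^+ 2) by apply: bmZ; exact: bmX.
have -> : \sum_(p < N) lambda p = \int[mu]_t (\sum_(p < N) lambda p * phi p t ^+ 2).
  rewrite bm_int_sum//; apply: eq_bigr => p _.
  rewrite bm_intZ; last exact: bmX.
  under eq_Rintegral do rewrite expr2.
  by rewrite phi_ortho eqxx; case: eqP => [->|_]; rewrite ?mul0r ?mulr1.
apply: bm_int_le => //; first by apply: bm_sum.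
move=> t; have := psd_spectral N (fun _ : 'I_1 => t) (fun=> 1).
rewrite !big_ord1 !mul1r => h; apply: le_trans h.
by apply: ler_sum => p _; rewrite big_ord1 mul1r.
Qed.

(** * Two-sided bounds of the IMSE for fixed sample points *)

Section Sandwich.
Variables (tau : R) (tau_gt0 : 0 < tau) (n : nat) (x : 'I_n -> T).

Lemma bm_sigma2 : bm (sigma2 k tau x).
Proof.
apply: bmB => //.
have -> : (fun t => ((kvec k x t)^T *m invmx (kmx k x + (n%:R * tau)%:M) *m
    kvec k x t) ord0 ord0) = (fun t => \sum_j (\sum_i k t (x i) *
      invmx (kmx k x + (n%:R * tau)%:M) i j) * k t (x j)).
  apply/funext => t; rewrite mxE; apply: eq_bigr => j _; rewrite !mxE.
  by congr (_ * _); apply: eq_bigr => i _; rewrite !mxE.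
have bX y : bm (fun t => k t y) by exact: (bm_slice1 bk y).
apply: bm_sum => j _; apply: bmM => //; apply: bm_sum => i _.
by apply: bmM => //; exact: bm_cst.
Qed.

Lemma IMSE_fin : IMSE mu k tau x = (\int[mu]_t sigma2 k tau x t)%:E.
Proof. by rewrite /IMSE bm_EFin_int//; exact: bm_sigma2. Qed.

Hypothesis n_gt0 : (0 < n)%N.

Definition emp_sqr p := (\sum_i phi p (x i) ^+ 2) / n%:R.

Definition emp_energy p :=
  (\sum_i \sum_j phi p (x i) * phi p (x j) * k (x i) (x j)) / n%:R ^+ 2.

Let nR : (n%:R : R) != 0.
Proof. by rewrite pnatr_eq0 -lt0n. Qed.

(* The right-hand side is the risk of the predictor with weights
   a_i(t) = n^-1 sum_(p < N) g_p phi_p(t) phi_p(x_i). *)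
Lemma imse_le N (g : nat -> R) : (forall p, lambda p = 0 -> g p = 0) ->
  \int[mu]_t sigma2 k tau x t <= \int[mu]_t k t t +
    \sum_(p < N) (g p ^+ 2 * emp_energy p + (tau * g p ^+ 2 - 2 * g p * lambda p) * emp_sqr p).
Proof.
move=> g0.
pose a i t := \sum_(p < N) (n%:R^-1 * g p * phi p (x i)) * phi p t.
have ba i : bm (a i) by apply: bm_sum => p _; exact: bmZ.
have bX y : bm (fun t => k t y) by exact: (bm_slice1 bk y).
(* Orthonormality in t removes the products with p != q, so that only the diagonal statistics
   [emp_sqr] and [emp_energy] can occur. *)
have aa i j : \int[mu]_t (a i t * a j t) =
    n%:R ^- 2 * \sum_(p < N) g p ^+ 2 * (phi p (x i) * phi p (x j)).
  rewrite (@int_phi_sum N (fun p => n%:R^-1 * g p * phi p (x i))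
    (fun p => n%:R^-1 * g p * phi p (x j))); last by move=> p /g0 ->; rewrite mulr0 mul0r.
  by rewrite big_distrr /=; apply: eq_bigr => p _; field.
have b1 : bm (fun t => \sum_i a i t * k t (x i)).
  by apply: bm_sum => i _; apply: bmM.
have b2 : bm (fun t => \sum_i \sum_j a i t * a j t * k (x i) (x j)).
  by apply: bm_sum => i _; apply: bm_sum => j _; apply: bmM; [exact: bmM | exact: bm_cst].
have b3 : bm (fun t => \sum_i a i t ^+ 2).
  by apply: bm_sum => i _; exact: bmX.
have b4 : bm (fun t => k t t - 2 * (\sum_i a i t * k t (x i))) by apply: bmB => //; exact: bmZ.
have b5 : bm (fun t => k t t - 2 * (\sum_i a i t * k t (x i)) +
    \sum_i \sum_j a i t * a j t * k (x i) (x j)) by exact: bmD.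
have b6 : bm (fun t => n%:R * tau * \sum_i a i t ^+ 2) by exact: bmZ.
apply: (@le_trans _ _ (\int[mu]_t predictor_risk k tau x t (a ^~ t))).
  apply: bm_int_le; [exact: bm_sigma2 | exact: bmD |].
  by move=> t; exact: sigma2_le.
rewrite /predictor_risk bm_intD// bm_intD// bm_intB//; last exact: bmZ.
rewrite !bm_intZ// -!addrA lerD2l.
rewrite !bm_int_sum; last 3 first.
- by move=> i _; exact: bmX.
- by move=> i _; apply: bm_sum => j _; apply: bmM; [exact: bmM | exact: bm_cst].
- by move=> i _; apply: bmM.
have -> : \sum_i \int[mu]_t (a i t * k t (x i)) = \sum_(p < N) g p * lambda p * emp_sqr p.
  transitivity (\sum_i n%:R^-1 * \sum_(p < N) g p * lambda p * phi p (x i) ^+ 2).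
    apply: eq_bigr => i _.
    under eq_Rintegral do rewrite mulrC k_psd.1.
    rewrite (int_kernel_phi_sum N (fun p => n%:R^-1 * g p * phi p (x i))).
    by rewrite big_distrr /=; apply: eq_bigr => p _; ring.
  under eq_bigr do rewrite big_distrr /=.
  rewrite exchange_big /=; apply: eq_bigr => p _.
  by rewrite /emp_sqr mulrA mulr_sumr mulr_suml; apply: eq_bigr => i _; ring.
have -> : \sum_i \int[mu]_t (a i t ^+ 2) = n%:R^-1 * \sum_(p < N) g p ^+ 2 * emp_sqr p.
  transitivity (\sum_i n%:R ^- 2 * \sum_(p < N) g p ^+ 2 * (phi p (x i) * phi p (x i))).
    by apply: eq_bigr => i _; rewrite -aa.
  under eq_bigr do rewrite big_distrr /=.
  rewrite exchange_big big_distrr /=; apply: eq_bigr => p _.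
  by rewrite /emp_sqr !mulrA mulr_sumr mulr_suml; apply: eq_bigr => i _; field.
have -> : \sum_i \int[mu]_t (\sum_j a i t * a j t * k (x i) (x j)) =
    \sum_(p < N) g p ^+ 2 * emp_energy p.
  transitivity (\sum_i \sum_j n%:R ^- 2 * (\sum_(p < N) g p ^+ 2 * (phi p (x i) * phi p (x j))) * k (x i) (x j)).
    apply: eq_bigr => i _; rewrite bm_int_sum; last first.
      by move=> j _; apply: bmM; [exact: bmM | exact: bm_cst].
    by apply: eq_bigr => j _; rewrite bm_intZr ?aa//; exact: bmM.
  under eq_bigr do under eq_bigr do rewrite big_distrr big_distrl /=.
  under eq_bigr do rewrite exchange_big /=.
  rewrite exchange_big /=; apply: eq_bigr => p _.
  rewrite /emp_energy mulrA mulr_sumr mulr_suml; apply: eq_bigr => i _.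
  by rewrite mulr_sumr mulr_suml; apply: eq_bigr => j _; ring.
rewrite le_eqVlt; apply/orP; left; apply/eqP.
(* The n of the noise variance n tau cancels the 1 / n of the integrated squared weights; this
   scaling keeps tau in the limit. *)
rewrite mulrA [_ * tau * _]mulrAC divff// mul1r !big_distrr -sumrN -!big_split /=.
by apply: eq_bigr => p _; ring.
Qed.

(** A duality argument, with multipliers c_p, that eliminates the unknown optimal weights a. Each
    square lambda_p (phi_p(t) - sum_i a_i phi_p(x_i))^2 and each noise term n tau a_i^2 is minorized
    by an expression affine in a; the parts linear in a cancel between the two families. *)
Lemma imse_ge N (c : nat -> R) : (forall p, lambda p = 0 -> c p = 0) ->
  \sum_(p < N) (2 * c p - c p ^+ 2 / lambda p - c p ^+ 2 / tau * emp_sqr p) <=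
  \int[mu]_t sigma2 k tau x t.
Proof.
move=> c0.
pose h i t := \sum_(p < N) (c p * phi p (x i)) * phi p t.
have bh i : bm (h i) by apply: bm_sum => p _; exact: bmZ.
pose l t := \sum_(p < N) (2 * c p - c p ^+ 2 / lambda p) * phi p t ^+ 2 -
  (n%:R * tau)^-1 * \sum_i h i t ^+ 2.
have b1 : bm (fun t => \sum_(p < N) (2 * c p - c p ^+ 2 / lambda p) * phi p t ^+ 2).
  by apply: bm_sum => p _; apply: bmZ; exact: bmX.
have b2 : bm (fun t => \sum_i h i t ^+ 2) by apply: bm_sum => i _; exact: bmX.
have -> : \sum_(p < N) (2 * c p - c p ^+ 2 / lambda p - c p ^+ 2 / tau * emp_sqr p) =
    \int[mu]_t l t.
  rewrite bm_intB//; last exact: bmZ.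
  rewrite bm_intZ// !bm_int_sum; last 2 first.
  - by move=> i _; exact: bmX.
  - by move=> p _; apply: bmZ; exact: bmX.
  have -> : \sum_i \int[mu]_t (h i t ^+ 2) = n%:R * \sum_(p < N) c p ^+ 2 * emp_sqr p.
    transitivity (\sum_i \sum_(p < N) c p ^+ 2 * phi p (x i) ^+ 2).
      apply: eq_bigr => i _; under eq_Rintegral do rewrite expr2.
      rewrite (@int_phi_sum N (fun p => c p * phi p (x i)) (fun p => c p * phi p (x i)));
        last by move=> p /c0 ->; rewrite mul0r.
      by apply: eq_bigr => p _; ring.
    rewrite exchange_big big_distrr /=; apply: eq_bigr => p _.
    by rewrite -mulr_sumr /emp_sqr; field.
  rewrite !big_distrr -sumrN -big_split /=; apply: eq_bigr => p _.
  congr (_ + _).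
    rewrite bm_intZ; last exact: bmX.
    under eq_Rintegral do rewrite expr2.
    rewrite phi_ortho eqxx; case: eqP => [/= l0|_]; last by rewrite mulr1.
    by rewrite c0// expr2 !(mulr0, mul0r) subrr.
  by field; rewrite nR gt_eqF.
apply: bm_int_le; [by apply: bmB => //; exact: bmZ | exact: bm_sigma2 |].
move=> t; have [a ->] := sigma2_attained k_psd tau_gt0 x t.
(* [psd_spectral] at the n + 1 points t, x_1, ..., x_n with weights 1, -a_1, ..., -a_n. *)
have hk : \sum_(p < N) lambda p * (phi p t - \sum_i a i * phi p (x i)) ^+ 2 <=
    k t t - 2 * (\sum_i a i * k t (x i)) + \sum_i \sum_j a i * a j * k (x i) (x j).
  have := psd_spectral N
    (fun i : 'I_n.+1 => if unlift ord0 i is Some j then x j else t)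
    (fun i : 'I_n.+1 => if unlift ord0 i is Some j then - a j else 1).
  rewrite big_ord_recl /= unlift_none.
  under [X in _ <= _ + X]eq_bigr do rewrite liftK big_ord_recl unlift_none.
  under [X in _ <= _ + X]eq_bigr do under eq_bigr do rewrite liftK.
  rewrite big_ord_recl unlift_none.
  under [X in _ <= _ + X + _]eq_bigr do rewrite liftK.
  under [X in X <= _]eq_bigr do rewrite big_ord_recl unlift_none.
  under [X in X <= _]eq_bigr do under eq_bigr do rewrite liftK.
  move=> hh.
  have e1 : \sum_(p < N) lambda p * (phi p t - \sum_i a i * phi p (x i)) ^+ 2 =
    \sum_(p < N) lambda p * (1 * phi p t + \sum_i - a i * phi p (x i)) ^+ 2.
    by apply: eq_bigr => p _; under [in RHS]eq_bigr do rewrite mulNr; rewrite sumrN mul1r.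
  rewrite e1; apply: le_trans hh _.
  rewrite le_eqVlt; apply/orP; left; apply/eqP.
  rewrite big_split /= !mul1r.
  under eq_bigr do rewrite mul1r mulNr.
  under [X in _ + (X + _)]eq_bigr do rewrite mulr1 mulNr k_psd.1.
  under [X in _ + (_ + X)]eq_bigr do under eq_bigr do rewrite mulrNN.
  by rewrite sumrN; ring.
rewrite /predictor_risk.
apply: le_trans (lerD hk (lexx _)) => {hk}.
(* The difference of the two sides is (lambda_p (f - s) - c_p f)^2 / lambda_p for each p; if
   lambda_p = 0, both sides vanish. *)
have hp : \sum_(p < N) ((2 * c p - c p ^+ 2 / lambda p) * phi p t ^+ 2 -
      2 * (c p * phi p t * \sum_i a i * phi p (x i))) <=
    \sum_(p < N) lambda p * (phi p t - \sum_i a i * phi p (x i)) ^+ 2.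
  apply: ler_sum => p _; set s := \sum_i _; set f := phi p t.
  have [l0|l0] := eqVneq (lambda p) 0.
    by rewrite c0// l0 !expr2 !(mulr0, mul0r) !subrr !(mulr0, mul0r).
  have lp : 0 < lambda p by rewrite lt_def l0 lambda_ge0.
  rewrite -subr_ge0.
  have -> : lambda p * (f - s) ^+ 2 - ((2 * c p - c p ^+ 2 / lambda p) * f ^+ 2 -
    2 * (c p * f * s)) = (lambda p * (f - s) - c p * f) ^+ 2 / lambda p by field.
  by rewrite divr_ge0// sqr_ge0.
apply: le_trans (lerD hp (lexx _)) => {hp}.
rewrite sumrB /l -addrA lerD2l.
have -> : \sum_(p < N) 2 * (c p * phi p t * \sum_i a i * phi p (x i)) =
    2 * \sum_i a i * h i t.
  rewrite -big_distrr /=; congr (_ * _).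
  under eq_bigr do rewrite big_distrr /=.
  rewrite exchange_big /=; apply: eq_bigr => i _; rewrite big_distrr /=.
  by apply: eq_bigr => p _; ring.
have m0 : 0 < n%:R * tau by rewrite mulr_gt0// ltr0n.
rewrite !big_distrr -!sumrN -big_split /=; apply: ler_sum => i _.
rewrite -subr_ge0; set m := n%:R * tau in m0 *.
have -> : - (2 * (a i * h i t)) + m * a i ^+ 2 - - (m^-1 * h i t ^+ 2) =
  (m * a i - h i t) ^+ 2 / m by field; rewrite gt_eqF.
by rewrite divr_ge0 ?sqr_ge0// ltW.
Qed.

End Sandwich.

End Spectral.

(** * Almost sure convergence, given eigenfunctions defined at every point *)

Section AlmostSure.
Context {R : realType} {dO dT : measure_display}.
Context {O : measurableType dO} {T : measurableType dT}.
Variables (P : probability O R) (mu : probability T R).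
Variables (X : nat -> {RV P >-> T}) (X_iid : iid_sample mu X).
Local Notation bm := bounded_measurable.
Variable k : T -> T -> R.
Hypotheses (bk : bm (fun z => k z.1 z.2)) (k_psd : psd_kernel k).
Variables (lambda : nat -> R) (phi : nat -> T -> R).
Hypothesis lambda_ge0 : forall p, 0 <= lambda p.
Hypothesis bphi : forall p, bm (phi p).
Hypothesis phi_ortho : forall p q,
  \int[mu]_x (phi p x * phi q x) = ((p == q) && (lambda p != 0))%:R.
Hypothesis phi_eigen : forall p x,
  \int[mu]_y (k x y * phi p y) = lambda p * phi p x.

Let A n w p := emp_sqr phi (fun i : 'I_n => X i w) p.
Let V n w p := emp_energy k phi (fun i : 'I_n => X i w) p.

(* The V-statistic of F is the squared norm, in the Hilbert space with kernel k,
   of the empirical mean of phi_p(X_i) k(X_i, .) minus its expectation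
   lambda_p phi_p; it dominates lambda_p (A - 1)^2. *)
Lemma emp_cvg p : lambda p != 0 ->
  {ae P, forall w, ((fun n => A n w p) @ \oo --> (1 : R)) /\
    ((fun n => V n w p) @ \oo --> lambda p)}.
Proof.
move=> l0; have lp : 0 < lambda p by rewrite lt_def l0 lambda_ge0.
set f := phi p; set l := lambda p in l0 lp *; have bf : bm f := bphi p.
pose F (z : T * T) := f z.1 * f z.2 * k z.1 z.2 - l * f z.1 ^+ 2 - l * f z.2 ^+ 2 + l.
have b1 : bm (fun z : T * T => f z.1) := bm_comp (@measurable_fst _ _ T T) (bphi p).
have b2 : bm (fun z : T * T => f z.2) := bm_comp (@measurable_snd _ _ T T) (bphi p).
have bF : bm F.
  apply: bmD; last exact: bm_cst.
  by repeat apply: bmB; [apply: bmM => //; exact: bmM | apply: bmZ; exact: bmX..].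
have ff : \int[mu]_x (f x ^+ 2) = 1.
  by under eq_Rintegral do rewrite expr2; rewrite phi_ortho eqxx l0.
(* Already the inner integral is 0 for every x: it equals l f(x)^2 - l f(x)^2 - l + l. *)
have F0 : \int[mu]_x \int[mu]_y F (x, y) = 0.
  rewrite -[RHS](prob_int_cst mu); apply: eq_Rintegral => x _; rewrite /F /=.
  have bkx : bm (fun y => f x * f y * k x y).
    by apply: bmM; [exact: (bmZ _ (bphi p)) | exact: (bm_slice2 bk x)].
  have bf2 : bm (fun y => l * f y ^+ 2) by apply: bmZ; exact: bmX.
  rewrite bm_intD; [|by repeat apply: bmB => //; exact: bm_cst|exact: bm_cst].
  rewrite bm_intB//; last by apply: bmB => //; exact: bm_cst.
  rewrite bm_intB//; last exact: bm_cst.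
  rewrite !prob_int_cst bm_intZ ?ff; last exact: bmX.
  under eq_Rintegral do rewrite -mulrA [f _ * k _ _]mulrC.
  rewrite bm_intZ; last by apply: bmM => //; exact: (bm_slice2 bk x).
  by rewrite phi_eigen -/f -/l; ring.
have Fsum n (x : 'I_n -> T) : \sum_i \sum_j F (x i, x j) =
    \sum_i \sum_j f (x i) * f (x j) * k (x i) (x j) -
    2 * l * n%:R * (\sum_i f (x i) ^+ 2) + l * n%:R ^+ 2.
  have row y : \sum_j F (y, x j) = \sum_j f y * f (x j) * k y (x j) -
      n%:R * (l * f y ^+ 2) - l * (\sum_j f (x j) ^+ 2) + n%:R * l.
    by rewrite /F /= !big_split !sumrN /= !sumr_const card_ord mulr_sumr !mulr_natl.
  under eq_bigr do rewrite row.
  rewrite !big_split !sumrN /= -!mulr_sumr !sumr_const card_ord -[(\sum_j _) *+ n]mulr_natl.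
  by rewrite -[l *+ n]mulr_natl; ring.
(* [psd_spectral] with weights f(x_i), of which only the term of index p is kept, bounds the energy
   below by l (sum_i f(x_i)^2)^2; the rest of [Fsum] completes the square. *)
have Fge n (x : 'I_n -> T) : l * (\sum_i f (x i) ^+ 2 - n%:R) ^+ 2 <= \sum_i \sum_j F (x i, x j).
  have := psd_spectral X_iid bk k_psd bphi phi_ortho phi_eigen p.+1 x (fun i => f (x i)).
  rewrite big_ord_recr /= -/f -/l Fsum.
  have : 0 <= \sum_(q < p) lambda q * (\sum_i f (x i) * phi q (x i)) ^+ 2.
    by apply: sumr_ge0 => q _; rewrite mulr_ge0// sqr_ge0.
  under [X in l * X ^+ 2]eq_bigr do rewrite -expr2.
  by lra.
have Fpos n (x : 'I_n -> T) : 0 <= \sum_i \sum_j F (x i, x j).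
  by apply: le_trans (Fge _ x); rewrite mulr_ge0// ?sqr_ge0// ltW.
have := vstat_slln X_iid bF F0 Fpos; apply: filterS => w.
set D := (fun n => _ / _) => D0.
have n0 : \forall n \near \oo, (0 < n)%N by exists 1%N.
have DE n : (0 < n)%N -> D n = V n w p - 2 * l * A n w p + l.
  move=> n_gt0; rewrite /D /vsum (Fsum n (fun i => X i w)) /V /A /emp_energy /emp_sqr -/f.
  by field; rewrite pnatr_eq0 -lt0n.
have Dge n : (0 < n)%N -> l * (A n w p - 1) ^+ 2 <= D n.
  move=> n_gt0; have n2 : 0 < (n%:R : R) ^+ 2 by rewrite exprn_gt0// ltr0n.
  rewrite /D ler_pdivlMr//; apply: le_trans (Fge n (fun i => X i w)).
  rewrite le_eqVlt; apply/orP; left; apply/eqP; rewrite /A /emp_sqr -/f.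
  by field; rewrite pnatr_eq0 -lt0n.
have A1 : (fun n => A n w p) @ \oo --> (1 : R).
  apply/cvgrPdist_lt => e e0.
  have le2 : 0 < l * e ^+ 2 by rewrite mulr_gt0// exprn_gt0.
  move/cvgrPdist_lt : (D0) => /(_ _ le2); apply: filterS2 n0 => n n_gt0.
  rewrite sub0r normrN => /(le_lt_trans (ler_norm _)) /(le_lt_trans (Dge n n_gt0)).
  rewrite ltr_pM2l// => h; rewrite distrC -(@ltr_pXn2r _ 2) ?nnegrE// ?ltW//.
  by rewrite real_normK ?num_real.
split => //.
have : (fun n => D n + 2 * l * A n w p - l) @ \oo --> 0 + 2 * l * 1 - l.
  by apply: cvgB; [apply: cvgD => //; exact: cvgMr | exact: cvg_cst].
have -> : 0 + 2 * l * 1 - l = l by ring.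
apply: cvg_trans; apply: near_eq_cvg; apply: filterS n0 => n n_gt0.
by rewrite DE//; ring.
Qed.

Variables (tau : R) (tau_gt0 : 0 < tau).
(** The converse of [sum_eigen_le_trace]. It expresses that no eigenvalue is missing from [lambda],
    and is obtained below from the completeness of the eigenbasis. *)
Hypothesis trace_le : ((\int[mu]_t k t t)%:E <= \sum_(0 <= p <oo) (lambda p)%:E)%E.

Lemma imse_cvg : {ae P, forall w,
  IMSE mu k tau (fun i : 'I_n => X i w) @[n --> \oo] -->
  (\sum_(0 <= p <oo) (tau * lambda p / (tau + lambda p))%:E)%E}.
Proof.
(* There are countably many p, so one null set serves for all of them; what follows is deterministic
   in w. *)
have : {ae P, forall w p, lambda p != 0 ->
    ((fun n => A n w p) @ \oo --> (1 : R)) /\ ((fun n => V n w p) @ \oo --> lambda p)}.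
  apply/ae_foralln => p; have [l0|l0] := eqVneq (lambda p) 0.
    by apply: aeW => w.
  by have := emp_cvg l0; apply: filterS => w.
apply: filterS => w AV.
pose tr := \int[mu]_t k t t.
pose c p := tau * lambda p / (tau + lambda p).
pose g p := lambda p / (tau + lambda p).
have tl p : 0 < tau + lambda p by rewrite ltr_wpDr.
have c0 p : 0 <= c p by rewrite divr_ge0 ?mulr_ge0// ltW.
have cl p : c p <= lambda p.
  rewrite /c ler_pdivrMr// mulrC ler_wpM2l//.
  by rewrite lerDl.
have cz p : lambda p = 0 -> c p = 0 by move=> l0; rewrite /c l0 mulr0 mul0r.
have gz p : lambda p = 0 -> g p = 0 by move=> l0; rewrite /g l0 mul0r.
pose L N := \sum_(p < N) lambda p; pose s N := \sum_(p < N) c p.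
have Ltr N : L N <= tr by exact: (sum_eigen_le_trace X_iid bk k_psd bphi phi_ortho phi_eigen).
have sL N M : (N <= M)%N -> s M - s N <= L M - L N.
  move=> NM; rewrite -(subnK NM); elim: (M - N)%N => [|m IH]; first by rewrite !subrr.
  have -> : s (m.+1 + N)%N = s (m + N)%N + c (m + N)%N by rewrite /s big_ord_recr.
  have -> : L (m.+1 + N)%N = L (m + N)%N + lambda (m + N)%N by rewrite /L big_ord_recr.
  by have := cl (m + N)%N; move: IH; lra.
have snd : nondecreasing_seq s.
  by apply/nondecreasing_seqP => n; rewrite /s big_ord_recr /= lerDl.
have scvg : cvgn s.
  apply: nondecreasing_is_cvgn => //; exists tr => _ [n _ <-].
  by apply: le_trans (Ltr n); apply: ler_sum.
pose S := limn s.
have -> : (\sum_(0 <= p <oo) (tau * lambda p / (tau + lambda p))%:E)%E = S%:E.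
  rewrite /S -EFin_lim//; congr (limn _); apply/funext => n.
  by rewrite big_mkord sumEFin.
have sS N : s N <= S by exact: nondecreasing_cvgn_le.
pose I n := \int[mu]_t sigma2 k tau (fun i : 'I_n => X i w) t.
have -> : (fun n => IMSE mu k tau (fun i : 'I_n => X i w)) = EFin \o I.
  by apply/funext => n; rewrite IMSE_fin.
apply: cvg_EFin; first by apply: nearW.
change ((fun n => I n) @ \oo --> S).
have Lcvg e : 0 < e -> exists N, tr - L N < e.
  move=> e0; apply: contrapT => /forallNP h.
  suff : (\sum_(0 <= p <oo) (lambda p)%:E <= (tr - e)%:E)%E.
    move=> /(le_trans trace_le); rewrite lee_fin -/tr; lra.
  apply: lime_le; first by apply: is_cvg_nneseries => p _ _; rewrite lee_fin.
  apply: nearW => N; rewrite big_mkord sumEFin lee_fin -/(L N).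
  by have /negP := h N; rewrite -leNgt; lra.
have lowC N : (fun n => \sum_(p < N) (2 * c p - c p ^+ 2 / lambda p - c p ^+ 2 / tau * A n w p)) @ \oo --> s N.
  apply: cvg_big => [|p _]; first exact: add_continuous.
  have [l0|l0] := eqVneq (lambda p) 0.
    rewrite cz//; under eq_fun do rewrite expr2 !(mulr0, mul0r) !subrr.
    exact: cvg_cst.
  have [A1 _] := AV p l0.
  have e : 2 * c p - c p ^+ 2 / lambda p - c p ^+ 2 / tau * 1 = c p.
    by rewrite /c; field; rewrite l0 !gt_eqF.
  have : (fun n => 2 * c p - c p ^+ 2 / lambda p - c p ^+ 2 / tau * A n w p) @ \oo -->
      2 * c p - c p ^+ 2 / lambda p - c p ^+ 2 / tau * 1.
    by apply: cvgB; [exact: cvg_cst | exact: cvgMr].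
  by rewrite e.
have uppC N : (fun n => tr + \sum_(p < N) (g p ^+ 2 * V n w p +
    (tau * g p ^+ 2 - 2 * g p * lambda p) * A n w p)) @ \oo --> tr - L N + s N.
  have -> : tr - L N + s N = tr + \sum_(p < N) (c p - lambda p) by rewrite sumrB -/(s N) -/(L N); ring.
  apply: cvgD; first exact: cvg_cst.
  apply: cvg_big => [|p _]; first exact: add_continuous.
  have [l0|l0] := eqVneq (lambda p) 0.
    rewrite gz// cz// l0; under eq_fun do rewrite expr2 !(mulr0, mul0r) !subrr mul0r addr0.
    by rewrite subrr; exact: cvg_cst.
  have [A1 V1] := AV p l0.
  have -> : c p - lambda p = g p ^+ 2 * lambda p + (tau * g p ^+ 2 - 2 * g p * lambda p) * 1.
    by rewrite /c /g; field; rewrite gt_eqF.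
  by apply: cvgD; exact: cvgMr.
apply/cvgrPdist_lt => e e0.
(* One quarter for the fluctuation of each bound and one for tr - L N, which by [SN] also controls
   the tail S - s N. *)
have e4 : 0 < e / 4 by rewrite divr_gt0.
have [N hN] := Lcvg _ e4.
have SN : S - s N <= tr - L N.
  rewrite lerBlDr; apply: limr_le => //; exists N => // M /= NM.
  by have := sL _ _ NM; have := Ltr M; lra.
have n0 : \forall n \near \oo, (0 < n)%N by exists 1%N.
move/cvgrPdist_lt : (lowC N) => /(_ _ e4) h1.
move/cvgrPdist_lt : (uppC N) => /(_ _ e4) h2.
near=> n.
have n_gt0 : (0 < n)%N by near: n.
have g1 := imse_ge X_iid bk k_psd lambda_ge0 bphi phi_ortho phi_eigen tau_gt0
  (fun i : 'I_n => X i w) n_gt0 N cz.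
have g2 := imse_le bk k_psd bphi phi_ortho phi_eigen tau_gt0
  (fun i : 'I_n => X i w) n_gt0 N gz.
have : `|s N - \sum_(p < N) (2 * c p - c p ^+ 2 / lambda p - c p ^+ 2 / tau * A n w p)| < e / 4.
  by near: n.
have : `|tr - L N + s N - (tr + \sum_(p < N) (g p ^+ 2 * V n w p +
    (tau * g p ^+ 2 - 2 * g p * lambda p) * A n w p))| < e / 4 by near: n.
rewrite !ltr_norml => /andP[h1a h1b] /andP[h2a h2b].
have := sS N; move: g1 g2; rewrite -/tr -/(I n) => g1 g2 h5.
by apply/andP; split; move: g1 g2 h1a h1b h2a h2b; rewrite -/(A n w _) -/(V n w _); lra.
Unshelve. all: by end_near. Qed.

End AlmostSure.

(** * The integral of the diagonal is at most the sum of the eigenvalues *)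

Section L2.
Context {R : realType} {d : measure_display} {T : measurableType d}.
Variable mu : probability T R.
Local Notation bm := bounded_measurable.
Local Notation integrable f := (mu.-integrable setT (EFin \o f)).

Lemma bm_Lfun2 (f : T -> R) : bm f -> f \in Lfun mu 2%:E.
Proof.
move=> bf; rewrite inE; apply/andP; split; rewrite inE /=; first exact: bf.1.
rewrite /finite_norm unlock poweR_lty//.
have -> : (\int[mu]_x `|(EFin \o f) x| `^ 2 = \int[mu]_x (f x ^+ 2)%:E)%E.
  by apply: eq_integral => x _ /=; rewrite powR_mulrn// real_normK// num_real.
by apply: integrable_lty => //; apply: (bm_integrable mu); exact: bmX.
Qed.

Lemma Lfun2_measurable (e : T -> R) : e \in Lfun mu 2%:E -> measurable_fun setT e.
Proof. by rewrite inE => /andP[]; rewrite inE. Qed.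

Lemma Lfun2_int (e : T -> R) : e \in Lfun mu 2%:E -> integrable e.
Proof.
move=> le; apply/Lfun1_integrable; apply: Lfun_subset12 => //.
by rewrite [X in X \is a fin_num](probability_setT mu).
Qed.

Lemma integrable_bmM (f h : T -> R) : bm f -> integrable h ->
  integrable (fun x => f x * h x).
Proof.
move=> [mf [M fM]] ih; apply: (integrableMr measurableT mf _ ih).
exists M; split; first exact: num_real.
by move=> N MN x _ /=; rewrite (le_trans (fM x))// ltW.
Qed.

Lemma integrable_sumR (J : Type) (r : seq J) (Q : pred J) (F : J -> T -> R) :
  (forall j, Q j -> integrable (F j)) ->
  integrable (fun x => \sum_(j <- r | Q j) F j x) /\
  \int[mu]_x (\sum_(j <- r | Q j) F j x) = \sum_(j <- r | Q j) \int[mu]_x F j x.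
Proof.
move=> iF; elim: r => [|j r [IH1 IH2]].
  rewrite big_nil; under eq_fun do rewrite big_nil.
  split; first exact: (bm_integrable mu (bm_cst 0)).
  by rewrite prob_int_cst.
rewrite big_cons; under eq_fun do rewrite big_cons.
case: (boolP (Q j)) => // Qj; split.
  exact: (integrableD measurableT (iF j Qj) IH1).
by rewrite RintegralD ?IH2//; exact: iF.
Qed.

Lemma Rintegral_indic (A : set T) : measurable A -> \int[mu]_x \1_A x = fine (mu A).
Proof. by move=> mA; rewrite /Rintegral integral_indic// setIT. Qed.

Lemma ae_eq_Rintegral (f g : T -> R) : measurable_fun setT f -> measurable_fun setT g ->
  {ae mu, forall x, f x = g x} -> \int[mu]_x f x = \int[mu]_x g x.
Proof.
move=> mf mg fg; congr fine; apply: ae_eq_integral => //.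
- exact/measurable_EFinP.
- exact/measurable_EFinP.
- by apply: filterS fg => x /= -> _.
Qed.

End L2.

Section KernelOperator.
Context {R : realType} {d : measure_display} {T : measurableType d}.
Variable mu : probability T R.
Local Notation bm := bounded_measurable.
Local Notation integrable f := (mu.-integrable setT (EFin \o f)).
Variable k : T -> T -> R.
Hypothesis bk : bm (fun z => k z.1 z.2).
Hypothesis k_sym : forall x y, k x y = k y x.

Let bkx x : bm (k x).
Proof. exact: (bm_slice2 bk x). Qed.

Let integrable_prod (f h : T -> R) : bm f -> integrable h ->
  (mu \x mu)%E.-integrable setT (EFin \o (fun z => f z.1 * k z.1 z.2 * h z.2)).
Proof.
move=> bf ih.
have bF : bm (fun z : T * T => f z.1 * k z.1 z.2).
  by apply: bmM => //; exact: (bm_comp (@measurable_fst _ _ T T) bf).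
have mh : measurable_fun setT h by apply/measurable_EFinP; exact: (measurable_int mu).
apply: (integrable_bmM (mu := (mu \x mu)%E) bF) => //.
have mh2 : measurable_fun setT (fun z : T * T => (h z.2)%:E).
  by apply/measurable_EFinP; exact: (measurableT_comp mh (@measurable_snd _ _ T T)).
apply/(integrable12ltyP mu mu mh2) => /=.
have /integrableP[_] := ih.
rewrite -[X in (X < _)%E -> _]mule1 -(probability_setT mu) -integral_cst//.
Qed.

(** Since k is bounded, |T h(x)| <= M int |h| at every x. This turns eigenfunctions that are merely
    square integrable into bounded ones. *)
Lemma bm_kernel_op (h : T -> R) : integrable h -> bm (kernel_op mu k h).
Proof.
move=> ih; split.
  have := measurable_fubini_F (integrable_prod (bm_cst 1) ih).
  move=> /(measurableT_comp (fine_measurable measurableT)).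
  apply: eq_measurable_fun => x _ /=; rewrite /kernel_op /Rintegral; congr fine.
  by apply: eq_integral => y _ /=; rewrite mul1r.
have [_ [M kM]] := bk.
exists (M * \int[mu]_y `|h y|) => x; rewrite /kernel_op.
apply: le_trans (le_normr_Rintegral _ (integrable_bmM (bkx x) ih)) _ => //.
have ih' : integrable (fun y => `|h y|).
  by have := integrable_abse ih.
rewrite -RintegralZl//; apply: le_Rintegral => //.
- by have := integrable_abse (integrable_bmM (bkx x) ih).
- exact: (integrable_bmM (bm_cst M) ih').
- by move=> y _; rewrite normrM ler_wpM2r//; exact: (kM (x, y)).
Qed.

Lemma kernel_op_sym (f h : T -> R) : bm f -> integrable h ->
  \int[mu]_x (f x * kernel_op mu k h x) = \int[mu]_y (kernel_op mu k f y * h y).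
Proof.
move=> bf ih; have iF := integrable_prod bf ih.
have E1 : (\int[mu]_x (f x * kernel_op mu k h x))%:E = (\int[mu]_x \int[mu]_y (f x * k x y * h y)%:E)%E.
  rewrite bm_EFin_int; last by apply: bmM => //; exact: bm_kernel_op.
  apply: eq_integral => x _; rewrite /kernel_op.
  have ikh := integrable_bmM (bkx x) ih.
  rewrite -RintegralZl// /Rintegral fineK.
    by apply: eq_integral => y _; rewrite mulrA.
  by apply: integrable_fin_num => //; exact: (integrable_bmM (bm_cst (f x)) ikh).
have if_ : integrable f by exact: bm_integrable.
have E2 : (\int[mu]_y (kernel_op mu k f y * h y))%:E = (\int[mu]_y \int[mu]_x (f x * k x y * h y)%:E)%E.
  rewrite /Rintegral fineK; last first.
    by apply: integrable_fin_num => //; exact: (integrable_bmM (bm_kernel_op if_) ih).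
  apply: eq_integral => y _; rewrite /kernel_op.
  have bkf : bm (fun x => k y x * f x) by apply: bmM.
  rewrite -bm_intZr// bm_EFin_int; last by apply: bmM => //; exact: bm_cst.
  by apply: eq_integral => x _; rewrite k_sym [k _ _ * _]mulrC.
by apply: EFin_inj; rewrite E1 E2; exact: (Fubini iF).
Qed.

Variables (I : set nat) (e : nat -> T -> R) (nu : nat -> R).
Hypothesis eb : eigenbasis mu k I e nu.

Lemma eigen_int i : I i -> integrable (e i).
Proof. by move=> Ii; apply: Lfun2_int; exact: (eb_L2 eb). Qed.

Let me i : I i -> measurable_fun setT (e i).
Proof. by move=> Ii; apply: (Lfun2_measurable (mu := mu)); exact: (eb_L2 eb). Qed.

Lemma eigen_dot_op (f : T -> R) i : bm f -> I i ->
  \int[mu]_x (kernel_op mu k f x * e i x) = nu i * \int[mu]_x (f x * e i x).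
Proof.
move=> bf Ii; rewrite -kernel_op_sym//; last exact: eigen_int.
have ife := integrable_bmM bf (eigen_int Ii).
rewrite -RintegralZl//; apply: ae_eq_Rintegral.
- by apply: measurable_funM; [exact: bf.1 | exact: (bm_kernel_op (eigen_int Ii)).1].
- apply: measurable_funM; first exact: measurable_cst.
  by apply: measurable_funM; [exact: bf.1 | exact: me].
- by apply: filterS (eb_eigen eb Ii) => x ->; rewrite mulrCA.
Qed.

(** Parseval's identity for the quadratic form of the operator: the remainder h_n of the expansion
    of f tends to 0 in L^2, and its product with T f integrates to at most the product of the L^2
    norms. *)
Lemma kernel_form_cvg (f : T -> R) : bm f ->
  (fun n => \sum_(i < n | (i : nat) \in I) nu i * (\int[mu]_x (f x * e i x)) ^+ 2)
    @ \oo --> \int[mu]_x (kernel_op mu k f x * f x).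
Proof.
move=> bf; pose g := kernel_op mu k f.
have bg : bm g by apply: bm_kernel_op; exact: bm_integrable.
pose h n x := f x - \sum_(i < n | (i : nat) \in I) dotL2 mu f (e i) * e i x.
have iS n : integrable (fun x => \sum_(i < n | (i : nat) \in I) dotL2 mu f (e i) * e i x).
  apply: (integrable_sumR _ _).1 => i /set_mem Ii.
  exact: (integrable_bmM (bm_cst _) (eigen_int Ii)).
have ih n : integrable (h n) by apply: (integrableB measurableT (bm_integrable mu bf) (iS n)).
have hE n : \int[mu]_x (g x * h n x) = \int[mu]_x (g x * f x) -
    \sum_(i < n | (i : nat) \in I) nu i * (\int[mu]_x (f x * e i x)) ^+ 2.
  rewrite /h; under eq_Rintegral do rewrite mulrBr.
  rewrite RintegralB//; last 2 first.
  - by apply: bm_integrable; apply: bmM.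
  - exact: integrable_bmM.
  congr (_ - _); under eq_Rintegral do rewrite mulr_sumr.
  have ii (i : 'I_n) : (i : nat) \in I ->
      integrable (fun x => g x * (dotL2 mu f (e i) * e i x)).
    move=> /set_mem Ii; apply: integrable_bmM => //.
    exact: (integrable_bmM (bm_cst _) (eigen_int Ii)).
  rewrite (integrable_sumR _ ii).2; apply: eq_bigr => i /set_mem Ii.
  under eq_Rintegral do rewrite mulrCA.
  rewrite RintegralZl//; last exact: (integrable_bmM bg (eigen_int Ii)).
  by rewrite eigen_dot_op// /dotL2 expr2 mulrCA.
have g2 : ('N[mu]_2%:E[EFin \o g] \is a fin_num)%E.
  rewrite ge0_fin_numE ?Lnorm_ge0//.
  by have := bm_Lfun2 mu bg; rewrite inE => /andP[_]; rewrite inE.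
have hN := eb_basis eb (bm_Lfun2 mu bf).
have : (`|\int[mu]_x (g x * h n x)|%:E @[n --> \oo] --> 0%:E)%E.
  apply: (squeeze_cvge (f := cst 0%E)
    (h := fun n => 'N[mu]_2%:E[EFin \o h n] * 'N[mu]_2%:E[EFin \o g])%E).
  - apply: nearW => n; rewrite lee_fin normr_ge0 /=.
    have mh : measurable_fun setT (h n).
      by apply/measurable_EFinP; exact: (measurable_int mu).
    have iN1 := integrable_bmM bg (ih n).
    apply: le_trans (hoelder mu (p := 2) (q := 2) mh bg.1 _ _ _) => //; last first.
      by rewrite [RHS]splitr !div1r.
    rewrite Lnorm1 EFin_normr_Rintegral//.
    apply: le_trans (le_abse_integral mu measurableT (measurable_int mu iN1)) _.
    by under eq_integral => x _ do rewrite /= mulrC.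
  - exact: cvg_cst.
  - by have := cvgeMr g2 hN; rewrite mul0e; apply.
move=> /fine_cvg /= h0.
have : (fun n => \int[mu]_x (g x * h n x)) @ \oo --> (0 : R).
  by apply/norm_cvg0P.
move=> h1.
have : (fun n => \int[mu]_x (g x * f x) - \int[mu]_x (g x * h n x)) @ \oo -->
  \int[mu]_x (g x * f x) - 0 by apply: cvgB => //; exact: cvg_cst.
by rewrite subr0; under eq_fun do rewrite hE opprB addrC subrK.
Qed.

(** Bessel's inequality for the unit vector e_i and the functions mu(D_j)^(-1/2) 1_(D_j), from int
    (e_i - q)^2 >= 0 with q the projection on their span. A null D_j contributes 0, as 0^-1 = 0. *)
Lemma indicator_bessel J (D : nat -> set T) i : I i ->
  (forall j, measurable (D j)) -> trivIset setT D ->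
  \sum_(j < J) (fine (mu (D j)))^-1 * (\int[mu]_x (\1_(D j) x * e i x)) ^+ 2 <= 1.
Proof.
move=> Ii mD tD.
pose m j : R := fine (mu (D j)); pose E j := \int[mu]_x (\1_(D j) x * e i x).
have bD j : bm (\1_(D j) : T -> R) by exact: bm_indic.
have DD j l : \int[mu]_x (\1_(D j) x * \1_(D l) x) = (j == l)%:R * m j.
  have [<-|jl] := eqVneq j l.
    rewrite mul1r /m -Rintegral_indic//; apply: eq_Rintegral => x _; rewrite indicE.
    by case: (x \in D j); rewrite ?mulr1 ?mulr0.
  rewrite mul0r -[RHS](prob_int_cst mu); apply: eq_Rintegral => x _; rewrite !indicE.
  have [/set_mem Djx|] := boolP (x \in D j); last by rewrite mul0r.
  have [/set_mem Dlx|] := boolP (x \in D l); last by rewrite mulr0.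
  by have := tD j l Logic.I Logic.I (ex_intro _ x (conj Djx Dlx)) => /eqP; rewrite (negbTE jl).
pose q x := \sum_(j < J) ((m j)^-1 * E j) * \1_(D j) x.
have bq : bm q by apply: bm_sum => j _; exact: bmZ.
have ie := eigen_int Ii.
have iqe := integrable_bmM bq ie.
have iee : integrable (fun x => e i x * e i x).
  by have := Lfun2_integrable_sqr (eb_L2 eb Ii).
have iqq : integrable (fun x => q x * q x) by apply: bm_integrable; exact: bmM.
have qe : \int[mu]_x (q x * e i x) = \sum_(j < J) (m j)^-1 * E j ^+ 2.
  under eq_Rintegral do rewrite mulr_suml.
  rewrite (integrable_sumR (mu := mu) _ _).2; last first.
    by move=> j _; apply: integrable_bmM => //; exact: bmZ.
  apply: eq_bigr => j _; under eq_Rintegral do rewrite -mulrA.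
  by rewrite RintegralZl//; [rewrite -/(E j); ring | exact: integrable_bmM].
have qq : \int[mu]_x (q x * q x) = \sum_(j < J) (m j)^-1 * E j ^+ 2.
  under eq_Rintegral do rewrite mulr_suml.
  rewrite bm_int_sum; last by move=> j _; apply: bmM => //; exact: bmZ.
  apply: eq_bigr => j _; under eq_Rintegral do rewrite mulr_sumr.
  rewrite bm_int_sum; last by move=> l _; apply: bmM; exact: bmZ.
  have ED (l : 'I_J) : \int[mu]_x ((m j)^-1 * E j * \1_(D j) x * ((m l)^-1 * E l * \1_(D l) x)) =
      (m j)^-1 * E j * ((m l)^-1 * E l) * (((j : nat) == l)%:R * m j).
    by rewrite -DD -(bm_intZ _ _ (bmM (bD j) (bD l))); apply: eq_Rintegral => x _; ring.
  rewrite (bigD1 j)//= ED eqxx mul1r big1 ?addr0; last first.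
    move=> l lj; have /negbTE ljn : (l : nat) != j by [].
    by rewrite ED eq_sym ljn mul0r mulr0.
  have [->|mj] := eqVneq (m j) 0; first by rewrite invr0 !mul0r.
  by field.
have ee : \int[mu]_x (e i x * e i x) = 1.
  by have := eb_orthonormal eb Ii Ii; rewrite eqxx.
have : 0 <= \int[mu]_x ((e i x * e i x - 2 * (q x * e i x)) + q x * q x).
  apply: Rintegral_ge0 => x _.
  have -> : e i x * e i x - 2 * (q x * e i x) + q x * q x = (e i x - q x) ^+ 2 by ring.
  exact: sqr_ge0.
have i2qe : integrable (fun x => 2 * (q x * e i x)) by exact: (integrable_bmM (bm_cst 2) iqe).
rewrite RintegralD//; last exact: (integrableB measurableT iee i2qe).
rewrite RintegralB// RintegralZl// ee qe qq -/(m _).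
by move: (\sum_(j < J) _) => s; lra.
Qed.

Hypothesis nu_ge0 : forall i, I i -> 0 <= nu i.
Variable L : R.
Hypothesis nu_sum : forall n, \sum_(i < n | (i : nat) \in I) nu i <= L.

(** After expansion in the eigenbasis and exchange of the sums, each nu_i carries a Bessel sum,
    which is at most 1. *)
Lemma indicator_trace_le J (D : nat -> set T) :
  (forall j, measurable (D j)) -> trivIset setT D ->
  \sum_(j < J) (fine (mu (D j)))^-1 *
    \int[mu]_x (kernel_op mu k \1_(D j) x * \1_(D j) x) <= L.
Proof.
move=> mD tD.
have bD j : bm (\1_(D j) : T -> R) by exact: bm_indic.
have : (fun n => \sum_(j < J) (fine (mu (D j)))^-1 *
    \sum_(i < n | (i : nat) \in I) nu i * (\int[mu]_x (\1_(D j) x * e i x)) ^+ 2) @ \oo -->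
  \sum_(j < J) (fine (mu (D j)))^-1 *
    \int[mu]_x (kernel_op mu k \1_(D j) x * \1_(D j) x).
  apply: cvg_big => [|j _]; first exact: add_continuous.
  by apply: cvgMr; exact: kernel_form_cvg.
move=> h; apply: (cvgr_to_le h); apply: nearW => n.
apply: le_trans (nu_sum n).
under eq_bigr do rewrite mulr_sumr.
rewrite exchange_big /=; apply: ler_sum => i /set_mem Ii.
rewrite -[leRHS]mulr1; apply: le_trans (ler_wpM2l (nu_ge0 Ii) (indicator_bessel J Ii mD tD)).
rewrite mulr_sumr le_eqVlt; apply/orP; left; apply/eqP.
by apply: eq_bigr => j _; ring.
Qed.

Hypothesis k_diag_ge0 : forall x, 0 <= k x x.

(* The normalized indicators of a partition into sets of small oscillation are
   orthonormal and almost diagonalize the trace. *)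
Lemma trace_le_bound :
  (forall eps : R, 0 < eps -> exists C : nat -> set T,
    [/\ forall j, measurable (C j), forall x, exists j, C j x &
      forall j x y, C j x -> C j y -> k x x <= k x y + eps]) ->
  \int[mu]_x k x x <= L.
Proof.
move=> cover.
have bkd : bm (fun x => k x x).
  apply: (bm_comp (h := fun t => (t, t)) _ bk).
  by apply/measurable_fun_pairP; split; exact: measurable_id.
apply/ler_addgt0Pr => eps eps0; have [C [mC covC oscC]] := cover _ eps0.
pose D := seqDU C.
have mD j : measurable (D j) by exact: seqDU_measurable.
have tD : trivIset setT D by exact: trivIset_seqDU.
have bD j : bm (\1_(D j) : T -> R) by exact: bm_indic.
have covD : \bigcup_j D j = setT.
  rewrite -seqDU_bigcup_eq; apply/seteqP; split => // x _.
  by have [j Cj] := covC x; exists j.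
have oscD j x y : D j x -> D j y -> k x x <= k x y + eps.
  by move=> Dx Dy; apply: (oscC j); exact: subset_seqDU.
have bkD j : bm (fun x => k x x * \1_(D j) x) by exact: bmM.
have int_ind j : \int[mu]_x (\1_(D j) x) = fine (mu (D j)).
  exact: Rintegral_indic.
(* For x and y in D_j, k(x, y) >= k(x, x) - eps; integration in y produces the factor mu(D_j), which
   is then divided out. For a null D_j both sides are handled directly. *)
have step j : \int[mu]_x (k x x * \1_(D j) x) - eps * fine (mu (D j)) <=
    (fine (mu (D j)))^-1 * \int[mu]_x (kernel_op mu k \1_(D j) x * \1_(D j) x).
  set m := fine (mu (D j)); have m0 : 0 <= m by exact: fine_ge0.
  have E : m * (\int[mu]_x (k x x * \1_(D j) x) - eps * m) <=
      \int[mu]_x (kernel_op mu k \1_(D j) x * \1_(D j) x).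
    have -> : m * (\int[mu]_x (k x x * \1_(D j) x) - eps * m) =
      \int[mu]_x ((k x x - eps) * m * \1_(D j) x).
      rewrite [in eps * m](esym (int_ind j) : m = _) -bm_intZ// -bm_intB//; last exact: bmZ.
      rewrite -bm_intZ; last by apply: bmB => //; exact: bmZ.
      by apply: eq_Rintegral => x _; ring.
    apply: bm_int_le.
    - by apply: bmM => //; apply: bmM; [apply: bmB => //; exact: bm_cst | exact: bm_cst].
    - by apply: bmM => //; apply: bm_kernel_op; exact: bm_integrable.
    move=> x; rewrite !indicE; have [/set_mem Dx|] := boolP (x \in D j); last by rewrite !mulr0.
    rewrite !mulr1 /kernel_op /m -int_ind -bm_intZ//; apply: bm_int_le; [exact: bmZ | exact: bmM |].
    move=> y; rewrite !indicE; have [/set_mem Dy|] := boolP (y \in D j); last by rewrite !mulr0.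
    by rewrite !mulr1 lerBlDr; exact: oscD Dx Dy.
  have [mz|mn0] := eqVneq m 0; last first.
    by rewrite ler_pdivlMl// lt_def mn0.
  rewrite mz invr0 mul0r mulr0 subr0.
  have [_ [M kM]] := bk.
  rewrite -[leRHS](mulr0 M) -mz /m -int_ind -bm_intZ//; apply: bm_int_le => //; first exact: bmZ.
  move=> x; apply: ler_wpM2r; first by rewrite indicE.
  exact: le_trans (ler_norm _) (kM (x, x)).
have sum_m J : \sum_(j < J) fine (mu (D j)) <= 1.
  under eq_bigr do rewrite -int_ind.
  rewrite -bm_int_sum//; rewrite -[leRHS](prob_int_cst mu); apply: bm_int_le.
  - exact: bm_sum.
  - exact: bm_cst.
  move=> x.
  have [[j Dj]|nD] := pselect (exists j : 'I_J, D j x); last first.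
    rewrite big1// => j _; rewrite indicE; case: (boolP (x \in D j)) => // /set_mem Dj.
    by case: nD; exists j.
  rewrite (bigD1 j)//= indicE mem_set// big1 ?addr0// => l lj.
  rewrite indicE; case: (boolP (x \in D l)) => // /set_mem Dl.
  have /eqP := tD l j Logic.I Logic.I (ex_intro _ x (conj Dl Dj)).
  by move=> lje; move: lj; rewrite -val_eqE /= lje.
have part J : \sum_(j < J) \int[mu]_x (k x x * \1_(D j) x) <= L + eps.
  rewrite -lerBlDr; apply: le_trans (indicator_trace_le J mD tD).
  apply: (@le_trans _ _ (\sum_(j < J) (\int[mu]_x (k x x * \1_(D j) x) - eps * fine (mu (D j))))).
    rewrite sumrB lerD2l lerN2 -mulr_sumr.
    by rewrite -[leRHS]mulr1 ler_wpM2l// ltW.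
  by apply: ler_sum => j _.
rewrite -lee_fin bm_EFin_int// -covD ge0_integral_bigcup//; last 2 first.
- by rewrite covD; apply/measurable_EFinP; exact: bkd.1.
- by move=> x _; rewrite lee_fin.
apply: lime_le; first by apply: is_cvg_nneseries => j _ _; apply: integral_ge0 => x _; rewrite lee_fin.
apply: nearW => J; rewrite big_mkord.
have E (j : 'I_J) : (\int[mu]_(x in D j) (k x x)%:E = (\int[mu]_x (k x x * \1_(D j) x))%:E)%E.
  rewrite bm_EFin_int// integral_mkcond; apply: eq_integral => x _.
  rewrite patchE indicE; case: ifPn => _; first by rewrite mulr1.
  by rewrite mulr0.
by under eq_bigr do rewrite E; rewrite sumEFin lee_fin.
Qed.

End KernelOperator.

(** * From an eigenbasis to bounded eigenfunctions indexed like [lambda] *)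

Section SortedEigenvalues.
Context {R : realType} {dO dT : measure_display}.
Context {O : measurableType dO} {T : measurableType dT}.
Variables (P : probability O R) (mu : probability T R).
Variables (X : nat -> {RV P >-> T}) (X_iid : iid_sample mu X).
Local Notation bm := bounded_measurable.
Variable k : T -> T -> R.
Hypotheses (bk : bm (fun z => k z.1 z.2)) (k_psd : psd_kernel k).
Hypothesis k_cover : forall eps : R, 0 < eps -> exists C : nat -> set T,
  [/\ forall j, measurable (C j), forall x, exists j, C j x &
    forall j x y, C j x -> C j y -> k x x <= k x y + eps].
Variables (tau : R) (tau_gt0 : 0 < tau).
Variables (lambda : nat -> R) (lambda_eig : sorted_eigenvalues mu k lambda).

Lemma imse_ae_cvg : {ae P, forall w,
  IMSE mu k tau (fun i : 'I_n => X i w) @[n --> \oo] -->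
  (\sum_(0 <= p <oo) (tau * lambda p / (tau + lambda p))%:E)%E}.
Proof.
have [_ lambda_ge0 [I [e [nu [s [eb s_bij s_eig]]]]]] := lambda_eig.
have k_sym := k_psd.1.
have [s_fun s_inj s_surj] := s_bij.
have sI p : lambda p != 0 -> I (s p).
  by move=> lp; have [] : I (s p) /\ nu (s p) != 0 by apply: s_fun.
have nuE i : I i -> nu i != 0 -> exists2 p, lambda p != 0 & s p = i.
  by move=> Ii ni; have [p lp <-] := s_surj i (conj Ii ni); exists p.
have nu_ge0 i : I i -> 0 <= nu i.
  move=> Ii; have [->//|ni] := eqVneq (nu i) 0.
  by have [p lp <-] := nuE i Ii ni; rewrite -s_eig.
(* phi_p is e_(s p) made into an eigenfunction at every point; it vanishes when
   lambda_p = 0, since then lambda_p^-1 = 0. *)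
pose phi p x := (lambda p)^-1 * kernel_op mu k (e (s p)) x.
have phi0 p : lambda p = 0 -> phi p = fun=> 0.
  by move=> l0; apply/funext => x; rewrite /phi l0 invr0 mul0r.
have bphi p : bm (phi p).
  have [l0|lp] := eqVneq (lambda p) 0; first by rewrite phi0//; exact: bm_cst.
  by apply: bmZ; apply: bm_kernel_op => //; apply: (eigen_int eb); exact: sI.
have phi_ae p : lambda p != 0 -> {ae mu, forall x, phi p x = e (s p) x}.
  move=> lp; apply: filterS (eb_eigen eb (sI _ lp)) => x.
  by rewrite /phi -s_eig// => ->; rewrite mulKf.
have me p : lambda p != 0 -> measurable_fun setT (e (s p)).
  by move=> lp; apply: (Lfun2_measurable (mu := mu)); apply: (eb_L2 eb); exact: sI.
have phi_ortho p q :
    \int[mu]_x (phi p x * phi q x) = ((p == q) && (lambda p != 0))%:R.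
  have [l0|lp] := eqVneq (lambda p) 0.
    rewrite andbF -[RHS](prob_int_cst mu); apply: eq_Rintegral => x _.
    by rewrite phi0// mul0r.
  rewrite andbT; have [l0|lq] := eqVneq (lambda q) 0.
    have /negbTE -> : p != q by apply: contra_neq lp => ->.
    rewrite -[RHS](prob_int_cst mu); apply: eq_Rintegral => x _.
    by rewrite (phi0 q)// mulr0.
  have -> : p == q = (s p == s q).
    by apply/eqP/eqP => [->//|]; apply: s_inj; rewrite inE.
  rewrite -(eb_orthonormal eb (sI _ lp) (sI _ lq)) /dotL2.
  apply: ae_eq_Rintegral.
  - exact: (bmM (bphi p) (bphi q)).1.
  - by apply: measurable_funM; exact: me.
  - by apply: filterS2 (phi_ae _ lp) (phi_ae _ lq) => x -> ->.
have phi_eigen p x : \int[mu]_y (k x y * phi p y) = lambda p * phi p x.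
  have [l0|lp] := eqVneq (lambda p) 0.
    rewrite l0 mul0r -[RHS](prob_int_cst mu); apply: eq_Rintegral => y _.
    by rewrite phi0// mulr0.
  rewrite /phi mulVKf// /kernel_op; apply: ae_eq_Rintegral.
  - exact: (bmM (bm_slice2 bk x) (bphi p)).1.
  - by apply: measurable_funM; [exact: (bm_slice2 bk x).1 | exact: me].
  - by apply: filterS (phi_ae _ lp) => y; rewrite /phi => ->.
apply: (imse_cvg X_iid bk k_psd lambda_ge0 bphi phi_ortho phi_eigen tau_gt0).
(* The spectrum [nu] may come in another order and with zeros in between. As the terms are
   nonnegative, the sum over the nonzero entries is an unordered one and is carried over by the
   bijection [s]. *)
have nuL n : (\sum_(i < n | (i : nat) \in I) (nu i)%:E <= \sum_(0 <= p <oo) (lambda p)%:E)%E.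
  pose Q i := (i \in I) && (nu i != 0%R).
  have -> : (\sum_(0 <= p <oo) (lambda p)%:E = \sum_(0 <= i <oo | Q i) (nu i)%:E)%E.
    transitivity (\sum_(0 <= p <oo | lambda p != 0%R) (lambda p)%:E)%E.
      rewrite [RHS]eseries_mkcond; congr (limn _); apply/funext => m.
      by apply: eq_bigr => p _; case: eqP => [->|].
    rewrite nneseries_esum; last by move=> p _; rewrite lee_fin.
    rewrite nneseries_esum; last by move=> i /andP[/set_mem Ii _]; rewrite lee_fin nu_ge0.
    have -> : [set i | Q i] = [set i | I i /\ nu i != 0].
      by apply/seteqP; split => i /= => [/andP[/set_mem]|[Ii ni]] => //; rewrite /Q mem_set.
    by rewrite (@reindex_esum R _ _ _ _ s (EFin \o nu) s_bij); apply: eq_esum => p /= lp; rewrite s_eig.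
  apply: le_trans (nneseries_lim_ge n _); last first.
    by move=> i _ /andP[/set_mem Ii _]; rewrite lee_fin nu_ge0.
  rewrite big_mkord [leRHS]big_mkcond [leLHS]big_mkcond /=; apply: lee_sum => i _.
  by rewrite /Q; case: ifPn => //= _; case: eqP => [->|].
(* An infinite sum makes the inequality trivial; a finite one provides the real number L for
   [trace_le_bound]. *)
have [->|] := eqVneq (\sum_(0 <= p <oo) (lambda p)%:E)%E +oo%E; first exact: leey.
rewrite -ltey => Lfin.
have Lf : (\sum_(0 <= p <oo) (lambda p)%:E \is a fin_num)%E.
  by rewrite ge0_fin_numE//; apply: nneseries_ge0 => p _ _; rewrite lee_fin.
rewrite -(fineK Lf) lee_fin.
apply: (trace_le_bound bk k_sym eb) => //.
- by move=> n; rewrite -lee_fin fineK// -sumEFin.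
- move=> x; have := k_psd.2 _ (fun _ : 'I_1 => x) (fun=> 1).
  by rewrite !big_ord1 !mul1r.
Qed.

End SortedEigenvalues.

(** * Measurability of the IMSE and convergence in probability *)

Section ImseMeasurable.
Context {R : realType} {dO dT : measure_display}.
Context {O : measurableType dO} {T : measurableType dT}.
Variables (P : probability O R) (mu : probability T R).
Variables (X : nat -> {RV P >-> T}).
Local Notation bm := bounded_measurable.
Variable k : T -> T -> R.
Hypotheses (bk : bm (fun z => k z.1 z.2)) (k_psd : psd_kernel k).
Variables (tau : R) (tau_gt0 : 0 < tau).

Let mk d (S : measurableType d) (f g : S -> T) :
  measurable_fun setT f -> measurable_fun setT g ->
  measurable_fun setT (fun z => k (f z) (g z)).
Proof.
move=> mf mg; apply: (measurableT_comp bk.1 (g := fun z => (f z, g z))).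
exact/measurable_fun_pairP.
Qed.

Lemma measurable_det d (S : measurableType d) n (A : S -> 'M[R]_n) :
  (forall i j, measurable_fun setT (fun z => A z i j)) ->
  measurable_fun setT (fun z => \det (A z)).
Proof.
move=> mA; rewrite /determinant; apply: measurable_sum => s.
apply: measurable_funM; first exact: measurable_cst.
by apply: measurable_prod => i _.
Qed.

(** By Cramer's formula an entry is a cofactor divided by the determinant, which stays in the
    complement of 0, where inversion is continuous. *)
Lemma measurable_invmx d (S : measurableType d) n (A : S -> 'M[R]_n) :
  (forall i j, measurable_fun setT (fun z => A z i j)) ->
  (forall z, A z \in unitmx) ->
  forall i j, measurable_fun setT (fun z => invmx (A z) i j).
Proof.
move=> mA uA i j.
under eq_fun do rewrite /invmx uA mxE mxE.
apply: measurable_funM.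
  apply: (@measurable_comp _ _ _ _ _ _ [set~ (0 : R)] (fun x => x^-1)).
  - exact: measurableC.
  - by move=> _ [z _ <-]; apply/eqP; rewrite -unitfE -unitmxE; exact: uA.
  - apply: open_continuous_measurable_fun.
      by apply: closed_openC; exact: closed_eq.
    by move=> x /set_mem /eqP x0; exact: inv_continuous.
  - exact: measurable_det.
apply: measurable_funM; first exact: measurable_cst.
by apply: measurable_det => i' j'; under eq_fun do rewrite !mxE; exact: mA.
Qed.

Lemma measurable_IMSE n :
  measurable_fun setT (fun w => IMSE mu k tau (fun i : 'I_n => X i w)).
Proof.
pose f (z : O * T) := sigma2 k tau (fun i : 'I_n => X i z.1) z.2.
have f0 z : (0 <= (f z)%:E)%E by rewrite lee_fin; exact: sigma2_ge0.
have mX (i : nat) : measurable_fun setT (fun z : O * T => X i z.1).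
  by apply: measurableT_comp => //; exact: measurable_fst.
have m2 : measurable_fun setT (fun z : O * T => z.2) by exact: measurable_snd.
have mf : measurable_fun setT (fun z => (f z)%:E).
  apply/measurable_EFinP; rewrite /f /sigma2.
  apply: measurable_funB; first exact: mk.
  under eq_fun do rewrite mxE.
  apply: measurable_sum => j; apply: measurable_funM; last first.
    by under eq_fun do rewrite mxE; exact: mk.
  under eq_fun do rewrite mxE.
  apply: measurable_sum => i; apply: measurable_funM.
    by under eq_fun do rewrite !mxE; exact: mk.
  apply: (measurable_invmx (A := fun z : O * T =>
    kmx k (fun i : 'I_n => X i z.1) + (n%:R * tau)%:M)).
    move=> i' j'; under eq_fun do rewrite !mxE.
    by apply: measurable_funD; [exact: mk | exact: measurable_cst].
  by move=> z; exact: kmx_unit.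
exact: (measurable_fun_fubini_tonelli_F (m2 := mu) _ mf f0).
Qed.

End ImseMeasurable.

(** The probability of a deviation is the integral of its indicator, which is eventually 0 at almost
    every w; dominated convergence applies with the constant 1. *)
Lemma ae_cvg_in_probability (R : realType) d (O : measurableType d)
    (P : probability O R) (Y : nat -> O -> \bar R) (l : \bar R) :
  l \is a fin_num -> (forall n, measurable_fun setT (Y n)) ->
  {ae P, forall w, Y n w @[n --> \oo] --> l} ->
  cvg_in_probability P Y l.
Proof.
move=> /fineK <- mY; move: (fine l) => {}l Yl e e0.
pose A n := [set w | (e%:E <= `| Y n w - l%:E |)%E].
have mA n : measurable (A n).
  have mYl : measurable_fun setT (fun w => `|Y n w - l%:E|%E).
    by apply: measurableT_comp => //; apply: emeasurable_funB => //; exact: measurable_cst.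
  by have := emeasurable_fun_c_infty measurableT mYl e%:E; rewrite setTI.
have Acvg : {ae P, forall w, [set: O] w ->
    (fun n => (\1_(A n) w : R)%:E) @ \oo --> (0 : \bar R)}.
  apply: filterS Yl => w /fine_cvgP [Yfin /cvgrPdist_lt /(_ _ e0) Yw] _.
  apply: cvg_near_cst; apply: filterS2 Yfin Yw => n fin /= h.
  rewrite indicE; case: (boolP (w \in A n)) => // /set_mem; rewrite /A /=.
  move: h; rewrite -(fineK fin) -EFinB lee_fin distrC.
  by rewrite ltNge => /negbTE ->.
have mIA n : measurable_fun setT (fun w => (\1_(A n) w : R)%:E).
  by apply/measurable_EFinP; exact: measurable_indic.
have dom : {ae P, forall w n, [set: O] w -> (`|(\1_(A n) w : R)%:E| <= cst 1%E w)%E}.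
  by apply: aeW => w n _; rewrite lee_fin indicE; case: (_ \in _); rewrite ?normr1 ?normr0.
have [_ _] := dominated_convergence measurableT mIA (measurable_cst 0%E) Acvg
  (bm_integrable P (bm_cst 1)) dom.
rewrite integral0; apply: cvg_trans; apply: near_eq_cvg; apply: nearW => n /=.
by rewrite integral_indic// setIT.
Qed.

(** * Positivity of a covariance kernel *)

Section CovarianceKernel.
Context {R : realType} {d : measure_display} {O : measurableType d}.
Variables (P : probability O R) (T : Type).
Variables (Z : T -> {RV P >-> R}) (m : T -> R) (k : T -> T -> R).
Hypothesis Z_gp : gaussian_process Z m k.

(** The quadratic form is the second moment of sum_i a_i (Z(x_i) - m(x_i)). The products are
    integrable because |a b| <= a^2 + b^2 and variances are finite. *)
Lemma gp_psd_kernel : psd_kernel k.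
Proof.
pose Y x w := Z x w - m x.
have covE x y : (\int[P]_w (Y x w * Y y w)%:E = (k x y)%:E)%E.
  by rewrite -(gp_cov Z_gp) covariance.unlock !(gp_mean Z_gp) unlock.
have mY x : measurable_fun setT (Y x).
  by apply: measurable_funB => //; exact: measurable_cst.
have iY2 x : P.-integrable setT (EFin \o (fun w => Y x w * Y x w)).
  apply/integrableP; split.
    by apply/measurable_EFinP; exact: measurable_funM.
  under eq_integral => w _ do rewrite /= ger0_norm ?sqr_ge0//.
  by rewrite covE ltry.
have iYY x y : P.-integrable setT (EFin \o (fun w => Y x w * Y y w)).
  apply: (le_integrable measurableT _ _ (integrableD measurableT (iY2 x) (iY2 y))).
    by apply/measurable_EFinP; exact: measurable_funM.
  move=> w _ /=; rewrite lee_fin [leRHS]ger0_norm; last first.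
    by rewrite addr_ge0// -expr2 sqr_ge0.
  by rewrite ler_norml; apply/andP; split; nra.
split=> [x y|I x a].
  by apply: EFin_inj; rewrite -!(gp_cov Z_gp) covarianceC.
have iaYY i j : P.-integrable setT (EFin \o (fun w => a i * a j * (Y (x i) w * Y (x j) w))).
  exact: (integrable_bmM (bm_cst (a i * a j)) (iYY (x i) (x j))).
have iS i : P.-integrable setT (EFin \o
    (fun w => \sum_j a i * a j * (Y (x i) w * Y (x j) w))).
  exact: (integrable_sumR _ (fun j _ => iaYY i j)).1.
have -> : \sum_i \sum_j a i * a j * k (x i) (x j) =
    \int[P]_w (\sum_i \sum_j a i * a j * (Y (x i) w * Y (x j) w)).
  rewrite (integrable_sumR _ (fun i _ => iS i)).2; apply: eq_bigr => i _.
  rewrite (integrable_sumR _ (fun j _ => iaYY i j)).2; apply: eq_bigr => j _.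
  by rewrite RintegralZl// /Rintegral covE.
apply: Rintegral_ge0 => w _.
have -> : \sum_i \sum_j a i * a j * (Y (x i) w * Y (x j) w) = (\sum_i a i * Y (x i) w) ^+ 2.
  rewrite expr2 mulr_suml; apply: eq_bigr => i _; rewrite mulr_sumr.
  by apply: eq_bigr => j _; ring.
exact: sqr_ge0.
Qed.

End CovarianceKernel.

(** Weights (1, 1) and (1, -1) at the points x, y give |k(x, y)| <= (k(x, x) + k(y, y)) / 2. *)
Lemma psd_kernel_norm_le (R : realType) (T : Type) (k : T -> T -> R) (M : R) :
  psd_kernel k -> (forall x, k x x <= M) -> forall x y, `|k x y| <= M.
Proof.
move=> k_psd kM x y.
have h (b : R) : 0 <= k x x + 2 * (b * k x y) + b * b * k y y.
  have := psd_kernel_sum (fun _ : 'I_1 => x) (fun _ : 'I_1 => y) (fun=> 1) (fun=> b) k_psd.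
  by rewrite !big_ord1 !mul1r.
have := h 1; have := h (-1); have := kM x; have := kM y.
by rewrite ler_norml => *; apply/andP; split; lra.
Qed.

(** * Rational balls: joint measurability and covers of small oscillation *)

Section RationalBalls.
Context {R : realType} {d : nat}.
Local Notation V := 'rV[R]_d.

Definition rat_ball (qm : 'rV[rat]_d * nat) : set V :=
  ball (map_mx ratr qm.1 : V) (qm.2.+1%:R^-1).

Lemma measurable_rat_ball qm : measurable (rat_ball qm : set (borelRd R d)).
Proof. by apply: sub_sigma_algebra; exact: ball_open. Qed.

Lemma rat_ball_basis (x : V) (U : set V) : nbhs x U ->
  exists qm, rat_ball qm x /\ rat_ball qm `<=` U.
Proof.
move=> /nbhs_ballP[r /= r0 rU].
(* Twice the radius has to be below r: x and any other point of the ball are both within one radius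
   of its centre. *)
have [m mr] : exists m : nat, 2 / m.+1%:R < r.
  exists (Num.bound (2 / r)); rewrite ltr_pdivrMr// mulrC -ltr_pdivrMr//.
  apply: lt_le_trans (archi_boundP _) _; first by rewrite divr_ge0// ltW.
  by rewrite ler_nat.
have [c cE [c0 c2]] : exists2 c : R, c = m.+1%:R^-1 & 0 < c /\ 2 * c < r.
  by exists m.+1%:R^-1 => //; split => //; rewrite invr_gt0.
have /fin_all_exists[q hq] (j : 'I_d) : exists q : rat, `|ratr q - x ord0 j| < c.
  have /rat_in_itvoo[q] : x ord0 j - c < x ord0 j + c by lra.
  by rewrite in_itv /= => /andP[q1 q2]; exists q; rewrite ltr_norml; apply/andP; split; lra.
exists (\row_j q j, m); split.
  by split => [|i j]; rewrite /= -cE// (ord1 i) /ball /= !mxE.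
move=> y; rewrite /rat_ball /= -cE => -[_ hy]; apply: rU; split => // i j; rewrite (ord1 i).
have := hy ord0 j; have := hq j; rewrite /ball /= !mxE.
move=> h1 h2; apply: lt_trans c2.
rewrite (_ : x ord0 j - y ord0 j = - (ratr (q j) - x ord0 j) + (ratr (q j) - y ord0 j)); last by ring.
by apply: le_lt_trans (ler_normD _ _) _; rewrite normrN; lra.
Qed.

Lemma rat_ball_cover (Q : set ('rV[rat]_d * nat)) :
  (forall x, exists qm, Q qm /\ rat_ball qm x) ->
  exists C : nat -> set (borelRd R d),
    [/\ forall j, measurable (C j), forall x, exists j, C j x &
      forall j x y, C j x -> C j y -> exists qm, [/\ Q qm, rat_ball qm x & rat_ball qm y]].
Proof.
move=> cov.
exists (fun n =>
  if choice.unpickle n : option ('rV[rat]_d * nat)%type is Some qm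
  then if `[< Q qm >] then rat_ball qm else set0 else set0).
split.
- move=> j; case: (choice.unpickle j) => // qm; case: ifP => _ //.
  exact: measurable_rat_ball.
- move=> x; have [qm [Qqm xqm]] := cov x; exists (choice.pickle qm).
  by rewrite choice.pickleK; case: asboolP.
- by move=> j x y; case: (choice.unpickle j) => // qm; case: asboolP => // Qqm bx bY; exists qm.
Qed.

(** Continuity yields open sets of the product topology, whereas the domain carries the product of
    two Borel sigma-algebras. An open set is therefore written as a countable union of products of
    rational balls. *)
Lemma measurable_continuous2 (k : V -> V -> R) :
  continuous (fun xy : V * V => k xy.1 xy.2) ->
  measurable_fun setT (fun z : borelRd R d * borelRd R d => k z.1 z.2).
Proof.
move=> kc; apply: (measurability _ (RGenOpens.measurableE R)).
move=> _ [_ [a [b ->] <-]]; rewrite setTI.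
pose U : set (V * V) := (fun xy => k xy.1 xy.2) @^-1` `]a, b[.
have oU : open U by apply: open_comp; [move=> z _; exact: kc | exact: interval_open].
pose F (i : ('rV[rat]_d * nat) * ('rV[rat]_d * nat)) : set (borelRd R d * borelRd R d) :=
  if `[< rat_ball i.1 `*` rat_ball i.2 `<=` U >] then rat_ball i.1 `*` rat_ball i.2 else set0.
suff -> : (fun z : borelRd R d * borelRd R d => k z.1 z.2) @^-1` `]a, b[ = \bigcup_i F i.
  apply: countable_bigcupT_measurable => // i; rewrite /F; case: ifP => // _.
  by apply: measurableX; exact: measurable_rat_ball.
apply/seteqP; split => [[x y] /= kxy|[x y] [i _]]; last first.
  by rewrite /F; case: asboolP => // sub /sub.
have : nbhs (x, y) U by apply: open_nbhs_nbhs; split.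
move=> [[A B] /= [nA nB] AB].
have [i [xi iA]] := rat_ball_basis nA; have [j [yj jB]] := rat_ball_basis nB.
exists (i, j) => //; rewrite /F; case: asboolP => [_ //|]; case.
by move=> [u v] /= [ui vj]; apply: AB; split; [exact: iA | exact: jB].
Qed.

(** By continuity at the diagonal point (x, x), some rational ball around x has a square on which k
    stays within eps / 2 of k(x, x). The radius may depend on x, since there are only countably many
    rational balls. *)
Lemma small_oscillation_cover (k : V -> V -> R) (eps : R) :
  continuous (fun xy : V * V => k xy.1 xy.2) -> 0 < eps ->
  exists C : nat -> set (borelRd R d),
    [/\ forall j, measurable (C j), forall x, exists j, C j x &
      forall j x y, C j x -> C j y -> k x x <= k x y + eps].
Proof.
move=> kc eps0.
pose Q : set ('rV[rat]_d * nat) := fun qm =>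
  forall x y, rat_ball qm x -> rat_ball qm y -> k x x <= k x y + eps.
have [|C [mC covC CQ]] := @rat_ball_cover Q; last first.
  by exists C; split => // j x y Cx Cy; have [qm [Qqm bx bY]] := CQ _ _ _ Cx Cy; exact: Qqm.
move=> x; have e2 : 0 < eps / 2 by rewrite divr_gt0.
have /cvgrPdist_lt /(_ _ e2) [[A B] /= [nA nB] AB] := kc (x, x).
have [qm [xqm qmAB]] := rat_ball_basis (filterI nA nB).
exists qm; split => // y z yb zb.
have [Ay By] := qmAB _ yb; have [Az Bz] := qmAB _ zb.
have := AB (y, y) (conj Ay By); have := AB (y, z) (conj Ay Bz).
by rewrite /= !ltr_norml => /andP[? ?] /andP[? ?]; lra.
Qed.

End RationalBalls.

Unset Implicit Arguments.

Theorem theorem2 (R : realType) (d : nat) (d_ge1 : (1 <= d)%N)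
  (mu : probability (borelRd R d) R)
  (dZ : measure_display) (OZ : measurableType dZ) (PZ : probability OZ R)
  (Z : 'rV[R]_d -> {RV PZ >-> R}) (m : 'rV[R]_d -> R)
  (k : 'rV[R]_d -> 'rV[R]_d -> R)
  (Z_gp : gaussian_process Z m k)
  (k_cont : continuous (fun xy : 'rV[R]_d * 'rV[R]_d => k xy.1 xy.2))
  (k_bound : (ereal_sup [set (k x x)%:E | x in [set: 'rV[R]_d]] < +oo)%E)
  (dO : measure_display) (O : measurableType dO) (P : probability O R)
  (X : nat -> {RV P >-> borelRd R d}) (X_iid : iid_sample mu X)
  (tau : R) (tau_gt0 : 0 < tau)
  (lambda : nat -> R) (lambda_eig : sorted_eigenvalues mu k lambda) :
  let imse := fun (n : nat) (w : O) =>
    IMSE mu k tau (fun i : 'I_n => X i w) in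
  let limit := (\sum_(0 <= p <oo) (tau * lambda p / (tau + lambda p))%:E)%E in
  (nondegenerate_spectrum lambda -> cvg_in_probability P imse limit) /\
  (degenerate_spectrum lambda ->
     {ae P, forall w, imse n w @[n --> \oo] --> limit}).
Proof.
move=> imse limit.
have k_psd := gp_psd_kernel Z_gp.
have [M kM] : exists M : R, forall x, k x x <= M.
  exists (fine (ereal_sup [set (k x x)%:E | x in [set: 'rV[R]_d]])) => x.
  have le_sup : ((k x x)%:E <= ereal_sup [set (k x x)%:E | x in [set: 'rV[R]_d]])%E.
    by apply: ereal_sup_ubound; exists x.
  rewrite -lee_fin fineK// fin_numE -ltey k_bound andbT.
  by rewrite -ltNye (lt_le_trans _ le_sup)// ltNyr.
have bk : bounded_measurable (fun z : borelRd R d * borelRd R d => k z.1 z.2).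
  split; first exact: measurable_continuous2.
  by exists M => z; exact: psd_kernel_norm_le.
have ae_cvg : {ae P, forall w, imse n w @[n --> \oo] --> limit}.
  apply: (imse_ae_cvg X_iid bk k_psd) => // eps eps0.
  exact: small_oscillation_cover.
split => // _; apply: ae_cvg_in_probability => //.
  (* The limit is finite: a set of full measure contains some w, and at this w all values of the
     IMSE lie between 0 and M. *)
  have PT : (0 < P setT)%E by rewrite [X in (_ < X)%E](probability_setT P) lte01.
  have [w lim_w] := @filter_ex _ _ (ae_properfilter_algebraOfSetsType PT) _ ae_cvg.
  have imse_bound n : (0 <= imse n w <= M%:E)%E.
    rewrite /imse (IMSE_fin mu bk) !lee_fin.
    rewrite Rintegral_ge0 /=; last by move=> t _; exact: sigma2_ge0.
    rewrite -(prob_int_cst mu M); apply: bm_int_le.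
    - exact: bm_sigma2.
    - exact: bm_cst.
    - by move=> t; apply: le_trans (kM t); exact: sigma2_le_var.
  rewrite ge0_fin_numE.
    apply: (@le_lt_trans _ _ M%:E); last by rewrite ltry.
    by apply: (cvge_to_le lim_w); apply: nearW => n; have /andP[] := imse_bound n.
  by apply: (cvge_to_ge lim_w); apply: nearW => n; have /andP[] := imse_bound n.
by move=> n; exact: measurable_IMSE.
Qed.
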